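(* For every digraph $D$ and every infinite family $\mathcal N$ of pairwise disjoint, pairwise equivalent necklaces in $D$ there exists a subgraph $D'$ of $D$ that is either a bidirected necklace grid or a cyclic necklace grid, such that each vertical necklace of $D'$ is an element of $\mathcal N$.
   Context: $\mathbb N=\{1,2,\dots\}$. Paths in digraphs are finite and directed. For vertex sets or subgraphs $A,B$, an $A$–$B$ path is a path that starts in $A$, ends in $B$ and has no inner vertex in $A\cup B$. An out-ray is a digraph whose underlying undirected graph is a ray (one-way infinite path) and whose edges are all oriented away from its unique vertex of degree $1$, its root. Necklaces. A necklace is a strongly connected (sub)digraph $N$ for which there is a family $(H_\ell)_{\ell\in\mathbb N}$ of finite strongly connected subgraphs of $N$ such that $N=\bigcup_{\ell}H_\ell$ and, for all $\ell,k$, $H_\ell\cap H_k\ne\emptyset$ if and only if $|\ell-k|\le1$. Such a family is a witness of $N$; the interior of $H_\ell$ is $V(H_\ell)\setminus(V(H_{\ell-1})\cup V(H_{\ell+1}))$ for $\ell>1$. Two necklaces $N_1,N_2$ in $D$ are equivalent if $D$ contains infinitely many pairwise disjoint $N_1$–$N_2$ paths and infinitely many pairwise disjoint $N_2$–$N_1$ paths. Quarter-grids. Let $(R_i)_{i\in\mathbb N}$ be pairwise disjoint out-rays. For a vertex set $X$ let $\lceil X\rceil$ be the union of $X$ and the set of all vertices $v$ lying on some $R_i$ such that the subray of $R_i$ with root $v$ contains a vertex of $X$; for a subgraph $G$ put $\lceil G\rceil:=\lceil V(G)\rceil$. For a sequence $i_1,\dots,i_n$ of indices ($n\ge 2$),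 a simple $i_1,\dots,i_n$-staircase is a path that is the concatenation of $P_1,Q_2,P_2,Q_3,\dots,Q_{n-1},P_{n-1}$, each consisting of exactly one edge, where $P_j$ is an edge from $R_{i_j}$ to $R_{i_{j+1}}$ and $Q_j$ is an edge of $R_{i_j}$ from the end vertex of $P_{j-1}$ to the start vertex of $P_j$. A digraph $Q=\bigcup_{i\in\mathbb N}R_i\cup\bigcup_{n\ge2}G_n$ is considered, where the digraphs $G_n$ (the girders) satisfy: $G_n$ avoids $\lceil G_i\rceil$ for all $2\le i<n$; $Q$ has no vertex whose in-degree and out-degree are both one; the first vertex of each $R_i$ lies in no $G_n$. - $Q$ is a bidirected quarter-grid if, for every $n\ge2$, $G_n$ is the concatenation of a simple $1,2,\dots,n$-staircase $S_n'$, an edge of $R_n$ and a simple $n,n-1,\dots,1$-staircase $S_n''$ such that $S_n''$ avoids $\lceil S_n'\rceil$. - $Q$ is an ascending cyclic quarter-grid if, for every $n\ge 2$, $G_n$ is the concatenation of a simple $1,2,\dots,n$-staircase $S_n$, an edge of $R_n$ and an edge $A_n$ from $R_n$ to $R_1$ such that $A_n$ avoids $\lceil S_n\rceil$. - $Q$ is a descending cyclic quarter-grid if, for every $n\ge2$, $G_n$ is the concatenation of an edge $A_n$ from $R_1$ to $R_n$, an edge of $R_n$ and a simple $n,n-1,\dots,1$-staircase $S_n$ such that $S_n$ avoids $\lceil A_n\rceil$. A cyclic quarter-grid is an ascending or a descending one. The $R_i$ are the vertical rays. In a subdivision, edges are replaced by internally disjoint directed paths of the same orientation; its vertical rays are the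 rays arising from the $R_i$, and its horizontal paths are the (pairwise disjoint) paths arising from the edges joining distinct vertical rays. Necklace grids. A bidirected (respectively cyclic) necklace grid is obtained from a subdivision of a bidirected (respectively cyclic) quarter-grid by replacing each vertical ray by a necklace. That is, it is the union of pairwise disjoint necklaces $N_i$ ($i\in\mathbb N$; the vertical necklaces), replacing the vertical rays $R_i$, each with a fixed witness $(H_\ell^{N_i})_{\ell\in\mathbb N}$, and pairwise disjoint paths $P'$, one for each horizontal path $P$, where if $P$ runs from $R_i$ to $R_j$ then $P'$ is a path from $N_i$ to $N_j$ internally disjoint from all the vertical necklaces, such that for every vertical necklace $N$: (a) for every odd $\ell$ there is at most one edge of the grid that is not in $E(N)$ and has its head or tail in $H_\ell^{N}$; (b) for every even $\ell$ there is no edge of the grid that is not in $E(N)$ and has its head or tail in the interior of $H_\ell^N$; (c) the endpoints of the paths $P'$ occur along $N_i$ in the same order as the endpoints of the paths $P$ along $R_i$: if $x$ precedes $y$ on $R_i$ and $x',y'\in V(N_i)$ are the corresponding endpoints, then $x'\in H^{N_i}_k$ and $y'\in H^{N_i}_\ell$ for some odd $k<\ell$. *)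

(* Defs.v *)
From mathcomp Require Import all_boot.
From mathcomp Require Import boolp classical_sets cardinality.

Set Implicit Arguments.
Unset Strict Implicit.
Unset Printing Implicit Defensive.

Local Open Scope classical_set_scope.

(* Indices start at 1 (the parity of an index matters below).  Indexed families are
   functions on [nat] that are only ever used at indices in [pos]; their value
   at 0 plays no role. *)
Definition pos : set nat := [set n | 0 < n].

(* Vertices are taken from an ambient type, so that the subgraphs of a digraph
   have the same type as the digraph itself. *)
Record digraph (V : Type) := Digraph {
  vert : set V;
  edge : set (V * V);
  edge_vert : forall e, edge e -> vert e.1 /\ vert e.2 }.

Lemma digraph_eq V (G H : digraph V) :
  vert G = vert H -> edge G = edge H -> G = H.
Proof.
case: G => vG eG pG; case: H => vH eH pH /= Ev Ee.
by subst vH eH; rewrite (Prop_irrelevance pG pH).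
Qed.

Definition subdigraph V (G H : digraph V) : Prop :=
  vert G `<=` vert H /\ edge G `<=` edge H.

Lemma bigdU_proof V I (A : set I) (F : I -> digraph V) e :
  (\bigcup_(i in A) edge (F i)) e ->
  (\bigcup_(i in A) vert (F i)) e.1 /\ (\bigcup_(i in A) vert (F i)) e.2.
Proof.
by case=> i Ai /edge_vert [e1 e2]; split; exists i.
Qed.

Definition bigdU V I (A : set I) (F : I -> digraph V) : digraph V :=
  Digraph (@bigdU_proof V I A F).

Lemma dU_proof V (G H : digraph V) e :
  (edge G `|` edge H) e ->
  (vert G `|` vert H) e.1 /\ (vert G `|` vert H) e.2.
Proof.
by case=> /edge_vert [e1 e2]; split; [left | left | right | right].
Qed.

Definition dU V (G H : digraph V) : digraph V := Digraph (@dU_proof V G H).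

Lemma edge_graph_proof V (u v : V) e :
  [set (u, v)] e -> [set u; v] e.1 /\ [set u; v] e.2.
Proof. by move=> ->; split; [left | right]. Qed.

Definition edge_graph V (u v : V) : digraph V := Digraph (@edge_graph_proof V u v).

(* A finite directed path p 0, ..., p (plen p); the values of [pvtx p] beyond
   [plen p] play no role. *)
Record dipath (V : Type) := Dipath {
  plen : nat;
  pvtx :> nat -> V;
  pvtx_inj : forall k l, k <= plen -> l <= plen -> pvtx k = pvtx l -> k = l }.

Definition pstart V (p : dipath V) : V := p 0.
Definition pend V (p : dipath V) : V := p (plen p).
Definition pinner V (p : dipath V) : set V := p @` [set k | 0 < k < plen p].

Lemma path_graph_proof V (p : dipath V) e :
  ((fun k => (p k, p k.+1)) @` [set k | k < plen p]) e ->
  (p @` [set k | k <= plen p]) e.1 /\ (p @` [set k | k <= plen p]) e.2.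
Proof. by case=> k /= kp <-; split; [exists k => //=; exact: ltnW | exists k.+1]. Qed.

Coercion path_graph V (p : dipath V) : digraph V := Digraph (@path_graph_proof V p).

(* The out-ray with root r 0 and edges (r k, r k.+1). *)
Record outray (V : Type) := Outray {
  rvtx :> nat -> V;
  rvtx_inj : injective rvtx }.

Lemma ray_graph_proof V (r : outray V) e :
  range (fun k => (r k, r k.+1)) e -> range r e.1 /\ range r e.2.
Proof. by case=> k _ <-; split; [exists k | exists k.+1]. Qed.

Coercion ray_graph V (r : outray V) : digraph V := Digraph (@ray_graph_proof V r).

Definition precedes V (r : outray V) (x y : V) : Prop :=
  exists k l, k < l /\ x = r k /\ y = r l.

Definition is_AB_path V (A B : set V) (p : dipath V) : Prop :=
  A (pstart p) /\ B (pend p) /\ pinner p `&` (A `|` B) = set0.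

Definition strongly_connected V (G : digraph V) : Prop :=
  forall u v, vert G u -> vert G v ->
    exists p : dipath V, subdigraph p G /\ pstart p = u /\ pend p = v.

Definition necklace_witness V (N : digraph V) (H : nat -> digraph V) : Prop :=
  (forall l, pos l ->
     subdigraph (H l) N /\ finite_set (vert (H l)) /\ strongly_connected (H l)) /\
  N = bigdU pos H /\
  (forall l k, pos l -> pos k ->
     (vert (H l) `&` vert (H k) !=set0 <-> l <= k.+1 /\ k <= l.+1)).

Definition necklace V (N : digraph V) : Prop :=
  strongly_connected N /\ exists H, necklace_witness N H.

(* Only meaningful for l > 1. *)
Definition interior V (H : nat -> digraph V) (l : nat) : set V :=
  vert (H l) `\` (vert (H l.-1) `|` vert (H l.+1)).

Definition inf_many_disjoint_paths V (D : digraph V) (A B : set V) : Prop :=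
  exists p : nat -> dipath V,
    (forall n, subdigraph (p n) D /\ is_AB_path A B (p n)) /\
    trivIset setT (fun n => vert (p n)).

Definition necklace_equiv V (D N1 N2 : digraph V) : Prop :=
  inf_many_disjoint_paths D (vert N1) (vert N2) /\
  inf_many_disjoint_paths D (vert N2) (vert N1).

Definition dclosure W (R : nat -> outray W) (X : set W) : set W :=
  X `|` [set v | exists i k l, pos i /\ k <= l /\ v = R i k /\ X (R i l)].

(* With s = [:: i_1; ...; i_n], the staircase visits
     x_1, y_2, x_2, y_3, ..., x_(n-1), y_n
   where P_j = (x_j, y_(j+1)) and Q_j = (y_j, x_j); hence x_(j+1) = p j.*2 and
   y_(j+2) = p j.*2.+1. *)
Definition simple_staircase W (R : nat -> outray W) (s : seq nat)
    (p : dipath W) : Prop :=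
  (plen p).+1 = (size s).-1.*2 /\
  (forall j, j < (size s).-1 ->
     vert (R (nth 0 s j)) (p j.*2) /\ vert (R (nth 0 s j.+1)) (p j.*2.+1)) /\
  (forall j, j.+1 < (size s).-1 ->
     edge (R (nth 0 s j.+1)) (p j.*2.+1, p j.*2.+2)).

Definition up_seq (n : nat) : seq nat := iota 1 n.
Definition down_seq (n : nat) : seq nat := rev (iota 1 n).

Definition bidirected_girder W (R : nat -> outray W) (n : nat) (G : digraph W) : Prop :=
  exists S1 S2 : dipath W,
    simple_staircase R (up_seq n) S1 /\
    simple_staircase R (down_seq n) S2 /\
    edge (R n) (pend S1, pstart S2) /\
    vert S2 `&` dclosure R (vert S1) = set0 /\
    G = dU (dU S1 (edge_graph (pend S1) (pstart S2))) S2.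

(* The edge A_n is (a, b). *)
Definition ascending_girder W (R : nat -> outray W) (n : nat) (G : digraph W) : Prop :=
  exists (S : dipath W) (a b : W),
    simple_staircase R (up_seq n) S /\
    vert (R n) a /\ vert (R 1) b /\
    edge (R n) (pend S, a) /\
    vert (edge_graph a b) `&` dclosure R (vert S) = set0 /\
    G = dU (dU S (edge_graph (pend S) a)) (edge_graph a b).

Definition descending_girder W (R : nat -> outray W) (n : nat) (G : digraph W) : Prop :=
  exists (S : dipath W) (a b : W),
    simple_staircase R (down_seq n) S /\
    vert (R 1) a /\ vert (R n) b /\
    edge (R n) (b, pstart S) /\
    vert S `&` dclosure R (vert (edge_graph a b)) = set0 /\
    G = dU (dU (edge_graph a b) (edge_graph b (pstart S))) S.

Definition quarter_grid W
    (girder : (nat -> outray W) -> nat -> digraph W -> Prop)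
    (R : nat -> outray W) (Q : digraph W) : Prop :=
  trivIset pos (fun i => vert (R i)) /\
  exists G : nat -> digraph W,
    (forall n, 2 <= n -> girder R n (G n)) /\
    (forall i n, 2 <= i -> i < n ->
       vert (G n) `&` dclosure R (vert (G i)) = set0) /\
    Q = dU (bigdU pos (fun i => R i : digraph W)) (bigdU [set n | 2 <= n] G) /\
    (forall v, vert Q v ->
       ~ ((exists! u, edge Q (u, v)) /\ (exists! w, edge Q (v, w)))) /\
    (forall i n, pos i -> 2 <= n -> ~ vert (G n) (R i 0)).

Definition bidirected_quarter_grid W (R : nat -> outray W) (Q : digraph W) : Prop :=
  quarter_grid (@bidirected_girder W) R Q.

Definition ascending_cyclic_quarter_grid W (R : nat -> outray W) (Q : digraph W) : Prop :=
  quarter_grid (@ascending_girder W) R Q.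

Definition descending_cyclic_quarter_grid W (R : nat -> outray W) (Q : digraph W) : Prop :=
  quarter_grid (@descending_girder W) R Q.

Definition cyclic_quarter_grid W (R : nat -> outray W) (Q : digraph W) : Prop :=
  ascending_cyclic_quarter_grid R Q \/ descending_cyclic_quarter_grid R Q.

(* T arises from Q by replacing each vertex v by [f v] and each edge e by the
   path [P e]. *)
Record subdivision W U (Q : digraph W) (T : digraph U)
    (f : W -> U) (P : W * W -> dipath U) : Prop := {
  subdiv_inj : forall u v, vert Q u -> vert Q v -> f u = f v -> u = v;
  subdiv_ends : forall e, edge Q e -> pstart (P e) = f e.1 /\ pend (P e) = f e.2;
  subdiv_branch : forall e, edge Q e -> pinner (P e) `&` (f @` vert Q) = set0;
  subdiv_inner : trivIset (edge Q) (fun e => pinner (P e));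
  subdiv_vert : vert T = (f @` vert Q) `|` \bigcup_(e in edge Q) vert (P e);
  subdiv_edge : edge T = \bigcup_(e in edge Q) edge (P e) }.

(* [r i] is the vertical ray of the subdivision that arises from [R i]. *)
Definition vertical_rays W U (R : nat -> outray W) (P : W * W -> dipath U)
    (r : nat -> outray U) : Prop :=
  forall i, pos i ->
    (r i : digraph U) = bigdU (edge (R i)) (fun e => P e : digraph U).

(* An edge of Q from R_i to R_j with i <> j.  The horizontal paths of a
   subdivision are the [P e] with e horizontal. *)
Definition horizontal W (R : nat -> outray W) (Q : digraph W) (i j : nat)
    (e : W * W) : Prop :=
  pos i /\ pos j /\ i <> j /\ edge Q e /\ vert (R i) e.1 /\ vert (R j) e.2.

Definition horizontal_edges W (R : nat -> outray W) (Q : digraph W) : set (W * W) :=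
  [set e | exists i j, horizontal R Q i j e].

(* x' is the endpoint of p' corresponding to the endpoint x of p. *)
Definition corresponding_ends U V (p : dipath U) (p' : dipath V) (x : U) (x' : V) : Prop :=
  (x = pstart p /\ x' = pstart p') \/ (x = pend p /\ x' = pend p').

(* D' is obtained from the subdivision with vertical rays [r] and horizontal
   paths [P e], for e in [horizontal_edges R Q], by replacing [r i] by the
   necklace [N i] with witness [H i], and [P e] by [P' e]. *)
Record ray_replacement W U V (R : nat -> outray W) (Q : digraph W)
    (P : W * W -> dipath U) (r : nat -> outray U)
    (D' : digraph V) (N : nat -> digraph V) (H : nat -> nat -> digraph V)
    (P' : W * W -> dipath V) : Prop := {
  repl_necklace : forall i, pos i -> necklace (N i) /\ necklace_witness (N i) (H i);
  repl_disjoint : trivIset pos (fun i => vert (N i));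
  repl_path_disjoint : trivIset (horizontal_edges R Q) (fun e => vert (P' e));
  repl_path_ends : forall i j e, horizontal R Q i j e ->
    vert (N i) (pstart (P' e)) /\ vert (N j) (pend (P' e));
  repl_path_inner : forall e k, horizontal_edges R Q e -> pos k ->
    pinner (P' e) `&` vert (N k) = set0;
  repl_union : D' = dU (bigdU pos N)
                       (bigdU (horizontal_edges R Q) (fun e => P' e : digraph V));
  repl_odd : forall i l, pos i -> odd l -> forall e1 e2,
    edge D' e1 -> ~ edge (N i) e1 -> vert (H i l) e1.1 \/ vert (H i l) e1.2 ->
    edge D' e2 -> ~ edge (N i) e2 -> vert (H i l) e2.1 \/ vert (H i l) e2.2 ->
    e1 = e2;
  repl_even : forall i l, pos i -> pos l -> ~~ odd l -> forall e,
    edge D' e -> ~ edge (N i) e ->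
    ~ (interior (H i) l e.1 \/ interior (H i) l e.2);
  repl_order : forall i, pos i -> forall e1 e2 x y x' y',
    horizontal_edges R Q e1 -> horizontal_edges R Q e2 ->
    corresponding_ends (P e1) (P' e1) x x' ->
    corresponding_ends (P e2) (P' e2) y y' ->
    precedes (r i) x y ->
    exists k l, odd k /\ odd l /\ k < l /\ vert (H i k) x' /\ vert (H i l) y' }.

Definition necklace_grid_over
    (grid : forall W : Type, (nat -> outray W) -> digraph W -> Prop)
    V (D' : digraph V) (N : nat -> digraph V) : Prop :=
  exists (W U : Type) (R : nat -> outray W) (Q : digraph W)
         (T : digraph U) (f : W -> U) (P : W * W -> dipath U) (r : nat -> outray U)
         (H : nat -> nat -> digraph V) (P' : W * W -> dipath V),
    grid W R Q /\ subdivision Q T f P /\ vertical_rays R P r /\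
    ray_replacement R Q P r D' N H P'.

(* In both definitions [N i], for i >= 1, are the vertical necklaces of D'. *)
Definition bidirected_necklace_grid V (D' : digraph V) (N : nat -> digraph V) : Prop :=
  necklace_grid_over bidirected_quarter_grid D' N.

Definition cyclic_necklace_grid V (D' : digraph V) (N : nat -> digraph V) : Prop :=
  necklace_grid_over cyclic_quarter_grid D' N.

(* Main.v *)
Require Import Defs.
From mathcomp Require Import all_boot.
From mathcomp Require Import boolp classical_sets functions cardinality.
From mathcomp Require Import zify.

(* Say that a necklace [N i] links to [N j] over a set [F] of necklaces if for every finite vertex set
   [X] there is a path from [N i] to [N j] avoiding [X] whose inner vertices avoid [N i], [N j] and
   all necklaces in [F]. Adding [N k] to [F] either keeps a link from [i] to [j] or splits it into
   links from [i] to [k] and from [k] to [j]; conversely, since a necklace remains connected far out,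
   two such links compose to one from [i] to [j] over [F] without [k]. These two rules suffice for
   the selection of the vertical necklaces. If infinitely many necklaces destroy one and the same
   link, Ramsey's theorem finds among them an infinite chain whose consecutive members stay linked in
   one direction over every finite part of the chain. Running back along such a chain, either
   consecutive members are linked as well (bidirected grid) or every member can be linked directly
   to the first one (cyclic grid). If there is no such chain, then links persist under suitable
   enlargements of [F], and there is an infinite family of pairwise linked necklaces (bidirected grid).
   The girders form one infinite tour of the rays, whose horizontal edges are routed one at a time
   along links, far out in the necklaces; each new necklace is chosen disjoint from the finitely many
   paths routed before. *)

Set Implicit Arguments.
Unset Strict Implicit.
Unset Printing Implicit Defensive.

Local Open Scope classical_set_scope.

(** * Infinite subsets of [nat] *)

Definition unbounded (Y : set nat) : Prop := forall m, exists2 k, m <= k & Y k.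

Lemma unbounded_above Y m : unbounded Y -> unbounded [set l | Y l /\ m < l].
Proof.
move=> uY k; have [l ml Yl] := uY (maxn k m.+1).
by exists l; [lia|split=> //; lia].
Qed.

Lemma not_unbounded Y : ~ unbounded Y -> exists m, forall l, Y l -> l < m.
Proof.
move=> /existsNP[m nm]; exists m => l Yl; rewrite ltnNge; apply/negP => ml.
by apply: nm; exists l.
Qed.

Lemma unbounded_range (g : nat -> nat) : {homo g : m n / m < n} -> unbounded (range g).
Proof.
move=> hg; have le_g n : n <= g n by elim: n => // n IH; apply: leq_ltn_trans IH (hg _ _ _).
by move=> m; exists (g m) => //; exists m.
Qed.

(** Dependent choice: [St s Y] relates the picks [s] made so far to the reservoir [Y] for all later
    ones. The conclusion keeps the reservoir from which [g n] was taken, so that what [St] says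
    about its members applies to [g n]. *)
Lemma fusion (St : seq nat -> set nat -> Prop) (Y0 : set nat) :
  St [::] Y0 ->
  (forall s Y, St s Y -> exists k Y',
     [/\ Y k, Y' `<=` Y, forall l, Y' l -> k < l & St (rcons s k) Y']) ->
  exists2 g : nat -> nat, {homo g : m n / m < n} &
    forall n, exists Y, [/\ St (mkseq g n) Y, Y `<=` Y0 & Y (g n)].
Proof.
move=> St0 step.
have /choice[F HF] : forall q : seq nat * set nat, exists r : nat * set nat,
    St q.1 q.2 -> [/\ q.2 r.1, r.2 `<=` q.2, forall l, r.2 l -> r.1 < l &
                      St (rcons q.1 r.1) r.2].
  move=> [s Y] /=; have [/step [k [Y' h]]|nSt] := pselect (St s Y).
    by exists (k, Y').
  by exists (0, set0).
pose q n := iter n (fun q => (rcons q.1 (F q).1, (F q).2)) ([::], Y0).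
have Sq n : St (q n).1 (q n).2 by elim: n => //= n /HF [].
pose g n := (F (q n)).1.
have qE n : (q n).1 = mkseq g n.
  by elim: n => //= n ->; rewrite /mkseq -[in RHS]addn1 iotaD map_cat cats1.
have Yg n : (q n).2 (g n) by case: (HF _ (Sq n)).
have subY m n : m <= n -> (q n).2 `<=` (q m).2.
  elim: n => [|n IH]; first by rewrite leqn0 => /eqP ->.
  rewrite leq_eqVlt => /orP[/eqP -> //|/IH]; apply: subset_trans.
  by case: (HF _ (Sq n)).
exists g => [m n mn|n].
  by case: (HF _ (Sq m)) => _ _ h _; apply: h; exact: (subY m.+1 n).
by exists (q n).2; split; rewrite -?qE //; exact: (subY 0 n).
Qed.

Lemma mem_mkseq_lt (g : nat -> nat) n k : k < n -> g k \in mkseq g n.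
Proof. by move=> kn; apply/mapP; exists k; rewrite // mem_iota. Qed.

(** If every infinite part of [Y] has a member related to infinitely many later ones of that part, a
    greedy choice gives the first case. Otherwise, in some infinite part each member is unrelated to
    almost all later ones, and the greedy choice works for the negation. *)
Lemma ramsey_pairs (R : nat -> nat -> Prop) (Y : set nat) : unbounded Y ->
  exists Z, [/\ unbounded Z, Z `<=` Y &
    (forall k l, Z k -> Z l -> k < l -> R k l) \/
    (forall k l, Z k -> Z l -> k < l -> ~ R k l)].
Proof.
move=> uY.
have greedy (T : nat -> nat -> Prop) Y0 : unbounded Y0 ->
    (forall Y', unbounded Y' -> Y' `<=` Y0 ->
       exists2 k, Y' k & unbounded [set l | [/\ Y' l, k < l & T k l]]) ->
    exists Z, [/\ unbounded Z, Z `<=` Y0 & forall k l, Z k -> Z l -> k < l -> T k l].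
  move=> uY0 H.
  have [|s Y' [uY' Y'Y0 sY']|g hg Hg] := @fusion (fun s Y' => [/\ unbounded Y', Y' `<=` Y0 &
      forall k l, k \in s -> Y' l -> T k l]) Y0; first by split.
    have [k Y'k uk] := H _ uY' Y'Y0.
    exists k, [set l | [/\ Y' l, k < l & T k l]]; split=> //; try by move=> l [].
    split=> //; first by move=> l [/Y'Y0].
    move=> m l; rewrite mem_rcons inE => /orP[/eqP -> [] //|ms [Y'l _ _]].
    exact: sY'.
  exists (range g); split; first exact: unbounded_range.
    by move=> _ [n _ <-]; have [Y' [_ + ]] := Hg n; apply.
  move=> _ _ [k _ <-] [l _ <-]; case: (ltnP k l) => [kl _|].
    by have [Y' [[_ _ h] _ Y'l]] := Hg l; apply: h => //; exact: mem_mkseq_lt.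
  rewrite leq_eqVlt => /orP[/eqP ->|/hg]; lia.
have [H|/existsNP[Y' /not_implyP[uY' /not_implyP[Y'Y nH]]]] :=
    pselect (forall Y', unbounded Y' -> Y' `<=` Y ->
       exists2 k, Y' k & unbounded [set l | [/\ Y' l, k < l & R k l]]).
  by have [Z [? ? ?]] := greedy R Y uY H; exists Z; split=> //; left.
have [|Z [uZ ZY' HZ]] := greedy (fun k l => ~ R k l) Y' uY'; last first.
  by exists Z; split=> //; [exact: subset_trans Y'Y|right].
move=> Y'' uY'' Y''Y'; have [k _ Y''k] := uY'' 0.
have [|m Hm] := @not_unbounded [set l | [/\ Y' l, k < l & R k l]].
  by move=> uk; apply: nH; exists k; [apply: Y''Y'|].
exists k => // n; have [l nl Y''l] := uY'' (maxn n (maxn m k.+1)).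
exists l; first by lia.
split=> //; first by lia.
move=> Rkl; suff : l < m by lia.
by apply: Hm; split=> //; [apply: Y''Y'|lia].
Qed.

(** * Links between the members of a family *)

(* [E F i j]: [i] is joined to [j] by infinitely many disjoint paths that avoid the other members
   of [F]. *)
Record link_system (E : set nat -> nat -> nat -> Prop) : Prop := {
  link_anti : forall F G i j, F `<=` G -> E G i j -> E F i j;
  link_split : forall F i j k,
    E F i j -> E (k |` F) i j \/ (E (k |` F) i k /\ E (k |` F) k j);
  link_join : forall F i j k, F i -> F j -> i <> j -> i <> k -> k <> j ->
    E F i k -> E F k j -> E (F `\ k) i j;
  link_pair : forall i j, i <> j -> E [set i; j] i j }.

Definition linked_down (E : set nat -> nat -> nat -> Prop) (s : seq nat) : Prop :=
  forall k, k.+1 < size s -> E [set` s] (nth 0 s k.+1) (nth 0 s k).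

Definition linked_up (E : set nat -> nat -> nat -> Prop) (s : seq nat) : Prop :=
  forall k, k.+1 < size s -> E [set` s] (nth 0 s k) (nth 0 s k.+1).

Definition all_finite (L : seq nat -> Prop) (Y : set nat) : Prop :=
  forall s, sorted ltn s -> [set` s] `<=` Y -> L s.

Section Links.
Variable E : set nat -> nat -> nat -> Prop.

(** Reversal of all links: it turns descending chains into ascending ones and spares the mirrored
    proofs. *)
Definition link_op (F : set nat) (i j : nat) : Prop := E F j i.

Hypothesis HE : link_system E.

Lemma link_system_op : link_system link_op.
Proof.
split; rewrite /link_op.
- by move=> F G i j; exact: (link_anti HE).
- by move=> F i j k /(link_split HE)-/(_ k) [|[]]; [left|right].
- move=> F i j k Fi Fj ij ik kj Eki Ejk.
  by apply: (link_join HE) => //; exact: nesym.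
- by move=> i j ij; rewrite setUC; apply: (link_pair HE); exact: nesym.
Qed.

Lemma link_via F i j k : E F i j -> ~ E (k |` F) i j -> E (k |` F) i k /\ E (k |` F) k j.
Proof. by move=> /(link_split HE)-/(_ k) []. Qed.

(* A path from [l] to [t] over [F] must run through all smaller elements of [Y] in decreasing order,
   so no link of [Y] skips an element. *)
Lemma separating_linked_down F t Y : F t -> (forall l, Y l -> ~ F l) ->
  (forall l, Y l -> E (l |` F) l t) ->
  (forall k l, Y k -> Y l -> k < l -> ~ E (l |` (k |` F)) l t) ->
  all_finite (linked_down E) Y.
Proof.
move=> Ft YF YE sep.
(* No link from [c] to [a] skips [b]: [a] keeps its link to [t] over [b] and [c], since otherwise
   [b] or [c] would have a forbidden one, so joining at [a] would link [c] to [t] over [b]. *)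
have no_skip a b c : Y a -> Y b -> Y c -> a < b -> b < c ->
    ~ E (c |` (b |` (a |` F))) c a.
  move=> Ya Yb Yc ab bc Eca.
  have Eat : E (b |` (a |` F)) a t.
    apply: contrapT => /(link_via (YE _ Ya)) [_].
    exact: (sep _ _ Ya Yb ab).
  have {}Eat : E (c |` (b |` (a |` F))) a t.
    apply: contrapT => /(link_via Eat) [_ Ect]; apply: (sep _ _ Yb Yc bc).
    by apply: (link_anti HE) Ect => x /=; tauto.
  apply: (sep _ _ Yb Yc bc); apply: (link_anti HE) (link_join HE _ _ _ _ _ Eca Eat).
  - move=> x xcbF; split; first by move: xcbF => /=; tauto.
    move=> /= xa; subst x; move: xcbF => /= [|[|/(YF _ Ya) //]]; lia.
  - by left.
  - by right; right; right.
  - by move=> ct; subst c; exact: (YF _ Yc).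
  - by lia.
  - by move=> ta; subst a; exact: (YF _ Ya).
(* The members of [s] are added one by one; one that destroyed the link from [q] to [p] would split
   it into two links, one of which skips [p] or [q]. *)
have gap p q (s : seq nat) : Y p -> Y q -> p < q ->
    (forall r, r \in s -> Y r /\ (r <= p \/ q <= r)) ->
    E ([set` s] `|` (p |` (q |` F))) q p.
  move=> Yp Yq pq; elim: s => [_|r s IH rs].
    rewrite set_nil set0U; apply: (proj1 (link_via (YE _ Yq) _)) => Eqt.
    by apply: (sep _ _ Yp Yq pq); apply: (link_anti HE) Eqt => x /=; tauto.
  have [Yr rpq] := rs r (mem_head _ _).
  have {IH}Epq : E ([set` s] `|` (p |` (q |` F))) q p.
    by apply: IH => r' r's; apply: rs; rewrite inE r's orbT.
  have [rE|rE] := pselect (r = p \/ r = q).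
    apply: (link_anti HE) Epq => x /= [|]; last by right.
    by rewrite inE => /orP[/eqP ->|]; [case: rE => ->; right; tauto|left].
  have sub : [set` r :: s] `|` (p |` (q |` F)) `<=` r |` ([set` s] `|` (p |` (q |` F))).
    by move=> x /= [|]; [rewrite inE => /orP[/eqP|]|]; tauto.
  apply: (link_anti HE sub); apply: contrapT => /(link_via Epq) [Eqr Erp].
  have [rp|pr] := ltnP r p.
    apply: (no_skip r p q) => //; apply: (link_anti HE) Eqr => x /=; tauto.
  have [qr|rq] := ltnP q r.
    apply: (no_skip p q r) => //; apply: (link_anti HE) Erp => x /=; tauto.
  by lia.
move=> s ss sY k ks; set p := nth 0 s k; set q := nth 0 s k.+1.
have sm i j : i < j -> j < size s -> nth 0 s i < nth 0 s j.
  by move=> ij js; apply: (sorted_ltn_nth ltn_trans) => //; rewrite inE //; exact: ltn_trans js.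
apply: (link_anti HE (G := [set` s] `|` (p |` (q |` F)))); first by move=> x; left.
apply: gap.
- by apply: sY; rewrite /= mem_nth // ltnW.
- by apply: sY; rewrite /= mem_nth.
- exact: sm.
move=> r rs; split; first exact: sY.
move/(nthP 0): rs => [i si <-].
have [ik|ki] := leqP i k.
  by left; move: ik; rewrite leq_eqVlt => /orP[/eqP -> //|ik]; apply/ltnW/sm => //; apply: ltnW.
right; move: ki; rewrite leq_eqVlt => /orP[/eqP <- //|ik]; exact/ltnW/sm.
Qed.
End Links.

(** Ramsey's theorem decides whether, for [k < l], the link from [l] to [t] survives [k]. If it
    never does, the members separate one another from [t] and form a descending chain. *)
Lemma thin_links E F t Y : link_system E -> F t -> (forall l, Y l -> ~ F l) ->
  unbounded Y -> (forall l, Y l -> E (l |` F) l t) ->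
  (exists Z, [/\ unbounded Z, Z `<=` Y & all_finite (linked_down E) Z]) \/
  (exists Z, [/\ unbounded Z, Z `<=` Y &
     forall k l, Z k -> Z l -> k < l -> E (l |` (k |` F)) l t]).
Proof.
move=> HE Ft YF uY YE.
have [Z [uZ ZY [RZ|RZ]]] := ramsey_pairs (fun k l => E (l |` (k |` F)) l t) uY.
  by right; exists Z.
left; exists Z; split=> //; apply: (@separating_linked_down E HE F t) => // l Zl; auto.
Qed.

(** * Infinite chains and rooted families *)

Definition no_infinite (L : seq nat -> Prop) : Prop :=
  forall Y, unbounded Y -> ~ all_finite L Y.

(* An infinite set of indices each of which destroys the link from [i] to [j] contains an infinite
   chain: thin it out towards [j], then away from [i]. *)
Lemma persistent_link E F i j : link_system E ->
  no_infinite (linked_down E) -> no_infinite (linked_up E) ->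
  F i -> F j -> i <> j -> E F i j -> exists m, forall l, m <= l -> E (l |` F) i j.
Proof.
move=> HE noD noU Fi Fj ij Eij; apply: contrapT => nm.
pose S := [set l | ~ E (l |` F) i j].
have uS : unbounded S.
  move=> m; apply: contrapT => nS; apply: nm; exists m => l ml.
  by apply: contrapT => ?; apply: nS; exists l.
have SF l : S l -> ~ F l.
  move=> Sl Fl; apply: Sl; apply: (link_anti HE) Eij => x /= [-> //|//].
have SE l : S l -> E (l |` F) i l /\ E (l |` F) l j by move=> Sl; exact: (link_via HE Eij).
have [[Z [uZ _ LZ]]|[Z [uZ ZS HZ]]] := thin_links HE Fj SF uS (fun l Sl => (SE l Sl).2).
  by case: (noD Z uZ).
have [[Z' [uZ' _ LZ']]|[Z' [uZ' Z'Z HZ']]] := thin_links (link_system_op HE) Fi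
  (fun l Zl => SF l (ZS l Zl)) uZ (fun l Zl => (SE l (ZS l Zl)).1).
  by case: (noU Z' uZ').
have [k _ Z'k] := uZ' 0; have [l kl Z'l] := uZ' k.+1.
(* For [k < l] in the set thinned twice, the links from [i] to [l] and from [l] to [j] both survive
   [k]; joined at [l], they link [i] to [j] over [k], although [k] destroys that link. *)
apply: (ZS _ (Z'Z _ Z'k)); apply: (link_anti HE (G := (l |` (k |` F)) `\ l)).
  move=> x /= xkF; split; first by tauto.
  by case: xkF => [->|Fx xl]; [lia|subst x; exact: (SF _ (ZS _ (Z'Z _ Z'l)))].
have Sl := SF _ (ZS _ (Z'Z _ Z'l)).
apply: (link_join HE) => //=; try by tauto.
- by move=> il; subst i.
- by move=> lj; subst j.
- exact: HZ'.
- by apply: HZ => //; exact: Z'Z.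
Qed.

Definition asc_cyclic (E : set nat -> nat -> nat -> Prop) (s : seq nat) : Prop :=
  linked_up E s /\ (1 < size s -> E [set` s] (last 0 s) (head 0 s)).

Definition desc_cyclic (E : set nat -> nat -> nat -> Prop) (s : seq nat) : Prop :=
  linked_down E s /\ (1 < size s -> E [set` s] (head 0 s) (last 0 s)).

Definition bidirected (E : set nat -> nat -> nat -> Prop) (s : seq nat) : Prop :=
  linked_up E s /\ linked_down E s.

(** The root [a] is to become ray 1. It is kept apart from [Y] because a cyclic family needs its
    closing links at this one member only. *)
Definition rooted_infinite (L : seq nat -> Prop) : Prop :=
  exists a Y, unbounded Y /\
    forall s, sorted ltn (a :: s) -> [set` s] `<=` Y -> L (a :: s).

Lemma rooted_all_finite (L : seq nat -> Prop) Y : unbounded Y -> all_finite L Y -> rooted_infinite L.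
Proof.
move=> uY LY; have [a _ Ya] := uY 0; exists a, Y; split=> // s ss sY.
by apply: LY => // x; rewrite /= inE => /orP[/eqP ->|/sY].
Qed.

Lemma set_cons_rcons (a k : nat) (s : seq nat) : [set` a :: rcons s k] = k |` [set` a :: s].
Proof.
apply/seteqP; split=> x /=; rewrite !inE mem_rcons inE.
  by case/or3P=> [/eqP ->|/eqP ->|->]; [right; rewrite eqxx|left|right; rewrite orbT].
by case=> [->|/orP[/eqP ->|->]]; rewrite ?eqxx ?orbT.
Qed.

(* Pick the members of the set one by one so that each still links to [a] over its predecessors; a
   failure separates infinitely many indices from [a] and hence yields a descending chain. *)
Lemma chain_rooted E Y : link_system E -> unbounded Y -> all_finite (linked_up E) Y ->
  rooted_infinite (bidirected E) \/ rooted_infinite (asc_cyclic E).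
Proof.
move=> HE uY UY; apply: contrapT => /not_orP[nB nA].
have [a _ Ya] := uY 0.
have noD Z : unbounded Z -> Z `<=` Y -> ~ all_finite (linked_down E) Z.
  move=> uZ ZY DZ; apply: nB; apply: (rooted_all_finite uZ) => s ss sZ.
  by split; [apply: UY => //; exact: subset_trans ZY|exact: DZ].
pose Y1 := [set l | Y l /\ a < l].
have [||g hg Hg] := @fusion (fun s Y' => [/\ unbounded Y', Y' `<=` Y1,
    forall l, Y' l -> l \notin s & forall l, Y' l -> E (l |` [set` a :: s]) l a]) Y1.
- split=> //; first exact: unbounded_above.
  move=> l [_ al]; have la : l <> a by lia.
  apply: (link_anti HE) (link_pair HE la) => x /=; rewrite inE => -[|/eqP]; tauto.
- move=> s Y' [uY' Y'Y1 Y's Y'E].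
  have [|l Y'l|[Z [uZ ZY' /noD]]|[Z [uZ ZY' ZE]]] := @thin_links E [set` a :: s] a Y' HE _ _ uY' Y'E.
  + by rewrite /= mem_head.
  + rewrite /= inE => /orP[/eqP la|]; last exact/negP/Y's.
    by have [_] := Y'Y1 _ Y'l; lia.
  + by case=> // l /ZY'/Y'Y1 [].
  have [k _ Zk] := uZ 0; exists k, [set l | Z l /\ k < l]; split=> //.
  + exact: ZY'.
  + by move=> l [/ZY'].
  + by move=> l [].
  split; first exact: unbounded_above.
  + by move=> l [/ZY'/Y'Y1].
  + by move=> l [/ZY'/Y's ls kl]; rewrite mem_rcons inE negb_or ls andbT; lia.
  by move=> l [Zl kl]; rewrite set_cons_rcons; exact: ZE.
apply: nA; exists a, (range g); split; first exact: unbounded_range.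
move=> s ss sg; split.
  apply: UY => // x; rewrite /= inE => /orP[/eqP -> //|/sg [n _ <-]].
  by have [Y' [_ Y'Y1 /Y'Y1[]]] := Hg n.
case/lastP: s ss sg => // s z ss sg _; rewrite last_cons last_rcons.
have [n _ zE] : range g z by apply: sg; rewrite /= mem_rcons mem_head.
have [Y' [[_ _ _ H] _ /H]] := Hg n; rewrite zE set_cons_rcons; apply: (link_anti HE).
move=> x /= [|xs]; [by left|right; move: xs; rewrite !inE => /orP[->//|xs]].
have [m _ xE] : range g x by apply: sg; rewrite /= mem_rcons inE xs orbT.
apply/orP; right; rewrite -xE; apply: mem_mkseq_lt => //.
have xz : x < z.
  move: ss; rewrite -rcons_cons (sorted_pairwise ltn_trans) pairwise_rcons => /andP[/allP H' _].
  by apply: (H' x); rewrite inE xs orbT.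
rewrite ltnNge; apply/negP; rewrite leq_eqVlt => /orP[/eqP nm|/hg]; last by lia.
by move: xz; rewrite -xE -zE nm ltnn.
Qed.

(* Without infinite chains every link persists, so one can collect indices that all stay linked to
   [0] in both directions; dropping [0] links all of them to one another. *)
Lemma star_rooted E : link_system E -> no_infinite (linked_down E) ->
  no_infinite (linked_up E) -> rooted_infinite (bidirected E).
Proof.
move=> HE noD noU.
pose star F l := E F l 0 /\ E F 0 l.
have [||g hg Hg] := @fusion (fun s Y => [/\ unbounded Y,
    forall l, Y l -> 0 < l /\ l \notin s, forall k, k \in s -> 0 < k /\ star [set` 0 :: s] k &
    forall l, Y l -> star (l |` [set` 0 :: s]) l]) [set l | 0 < l].
- split=> //.
  + by move=> m; exists m.+1 => /=.
  + move=> l l0; have ln0 : l <> 0 by move=> l0'; rewrite l0' in l0.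
    split; [apply: (link_anti HE) (link_pair HE ln0)|
            apply: (link_anti HE) (link_pair HE (nesym ln0))] => x /=;
    by rewrite inE => -[|/eqP]; tauto.
- move=> s Y [uY Ys sE YE].
  have YF l : Y l -> ~ [set` 0 :: s] l.
    move=> Yl; have [l0 /negP ls] := Ys l Yl.
    by rewrite /= inE => /orP[/eqP|//]; lia.
  have F0 : [set` 0 :: s] 0 by rewrite /= mem_head.
  have [[Z [uZ _ /noD]]|[Z [uZ ZY ZE]]] := thin_links HE F0 YF uY (fun l Yl => (YE l Yl).1).
    by case/(_ uZ).
  have [[Z' [uZ' _ /noU]]|[Z' [uZ' Z'Z Z'E]]] := thin_links (link_system_op HE) F0
    (fun l Zl => YF l (ZY l Zl)) uZ (fun l Zl => (YE l (ZY l Zl)).2).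
    by case/(_ uZ').
  (* The links between [0] and the finitely many earlier picks persist beyond some bound, above
     which the next pick is taken. *)
  have [m Hm] : exists m, forall l, m <= l -> forall k, k \in s -> star (l |` [set` 0 :: s]) k.
    have : {subset s <= s} by [].
    elim: {1 3}s => [_|k s' IH ks]; first by exists 0.
    have [|m Hm] := IH; first by move=> x xs; apply: ks; rewrite inE xs orbT.
    have /sE[k0 [Ek0 E0k]] : k \in s by apply: ks; rewrite mem_head.
    have Fk : [set` 0 :: s] k by rewrite /= inE ks ?orbT ?mem_head.
    have kn0 : k <> 0 by lia.
    have [m1 Hm1] := persistent_link HE noD noU Fk F0 kn0 Ek0.
    have [m2 Hm2] := persistent_link HE noD noU F0 Fk (nesym kn0) E0k.
    exists (maxn m (maxn m1 m2)) => l; rewrite !geq_max => /and3P[lm lm1 lm2] k'.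
    rewrite inE => /orP[/eqP ->|]; last exact: Hm.
    by split; [exact: Hm1|exact: Hm2].
  have [k mk Z'k] := uZ' m; exists k, [set l | Z' l /\ k < l]; split=> //.
  + by apply: ZY; exact: Z'Z.
  + by move=> l [/Z'Z/ZY].
  + by move=> l [].
  rewrite set_cons_rcons; split.
  + exact: unbounded_above.
  + move=> l [/Z'Z/ZY/Ys[l0 ls] kl]; split=> //.
    by rewrite mem_rcons inE negb_or ls andbT; lia.
  + move=> k'; rewrite mem_rcons inE => /orP[/eqP ->|k's]; last first.
      by split; [case: (sE k' k's)|exact: Hm].
    have Yk : Y k by apply: ZY; exact: Z'Z.
    by split; [case: (Ys k Yk)|exact: YE].
  + by move=> l [Z'l kl]; split; [apply: ZE => //; exact: Z'Z|exact: Z'E].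
(* Joining the links from [p] to [0] and from [0] to [q] drops [0]. Both are taken at a stage past
   the maximum of [s]; as [n <= g n], all entries of [s] have been picked by then. *)
have pairE (s : seq nat) : [set` s] `<=` range g ->
    forall p q, p \in s -> q \in s -> p <> q -> E [set` s] p q.
  move=> sg p q ps qs pq.
  have le_g n : n <= g n by elim: n => // n IH; apply: leq_ltn_trans IH (hg _ _ _).
  have [Y [[_ _ sE _] _ _]] := Hg (\max_(x <- s) x).+1.
  have sub x : x \in s -> x \in mkseq g (\max_(x <- s) x).+1.
    move=> xs; have [n _ nx] := sg x xs; rewrite -nx; apply: mem_mkseq_lt => //.
    by rewrite ltnS; apply: leq_trans (le_g n) _; rewrite nx; apply: leq_bigmax_seq.
  have [p0 [Ep0 _]] := sE p (sub _ ps); have [q0 [_ E0q]] := sE q (sub _ qs).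
  apply: (link_anti HE (G := [set` 0 :: mkseq g (\max_(x <- s) x).+1] `\ 0)).
    move=> x xs; split; first by rewrite /= inE sub ?orbT.
    by move=> /= x0; have [] := sE x (sub _ xs); rewrite x0.
  apply: (link_join HE) => //.
  - by rewrite /= inE sub ?orbT.
  - by rewrite /= inE sub ?orbT.
  - by lia.
  - by lia.
apply: (@rooted_all_finite _ (range g)); first exact: unbounded_range.
move=> s ss sg.
have ne k : k.+1 < size s -> nth 0 s k <> nth 0 s k.+1.
  move=> ks; have : nth 0 s k < nth 0 s k.+1; last by lia.
  by apply: (sorted_ltn_nth ltn_trans); rewrite ?inE // ltnW.
split=> k ks; apply: pairE => //; rewrite ?mem_nth //; try exact: ltnW.
  exact: ne.
exact/nesym/ne.
Qed.

Theorem linked_subfamily E : link_system E ->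
  rooted_infinite (bidirected E) \/ rooted_infinite (asc_cyclic E) \/
  rooted_infinite (desc_cyclic E).
Proof.
move=> HE.
have [noU|/existsNP[Y /not_implyP[uY /contrapT UY]]] :=
    pselect (no_infinite (linked_up E)); last first.
  by have [] := chain_rooted HE uY UY; [left|right; left].
have [noD|/existsNP[Y /not_implyP[uY /contrapT DY]]] :=
    pselect (no_infinite (linked_down E)); last first.
  have [[a [Z [uZ ZB]]]|] := chain_rooted (link_system_op HE) uY DY; last by right; right.
  by left; exists a, Z; split=> // s ss sZ; have [? ?] := ZB s ss sZ; split.
by left; exact: star_rooted.
Qed.

(** * Walks and necklaces *)

(* Walks with at least one edge and all inner vertices in [S]; the ends need not be in [S]. *)
Inductive walk V (D : digraph V) (S : set V) : V -> V -> Prop :=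
| walk_edge u v : edge D (u, v) -> walk D S u v
| walk_step u w v : edge D (u, w) -> S w -> walk D S w v -> walk D S u v.

Section Walks.
Variable V : Type.
Implicit Types (D : digraph V) (S K X : set V).

Lemma walk_sub D D' S S' u v : edge D `<=` edge D' -> S `<=` S' ->
  walk D S u v -> walk D' S' u v.
Proof.
move=> sD sS; elim=> {u v} [u v uv|u w v uw Sw _ IH]; first exact/walk_edge/sD.
by apply: walk_step IH; [exact: sD|exact: sS].
Qed.

Lemma walk_cat D S u w v : walk D S u w -> S w -> walk D S w v -> walk D S u v.
Proof.
move=> uw; elim: uw v => {u w} [u w uw|u x w ux Sx _ IH] v Sw wv.
  exact: walk_step wv.
by apply: walk_step ux Sx _; exact: IH.
Qed.

Lemma walk_first_hit D S K u v : walk D S u v ->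
  walk D (S `\` K) u v \/ exists w, [/\ S w, K w, walk D (S `\` K) u w & walk D S w v].
Proof.
elim=> {u v} [u v uv|u w v uw Sw wv IH]; first by left; exact: walk_edge.
have [Kw|nKw] := pselect (K w); first by right; exists w; split=> //; exact: walk_edge.
case: IH => [wv'|[x [Sx Kx wx xv]]]; first by left; exact: walk_step wv'.
by right; exists x; split=> //; exact: walk_step wx.
Qed.

Lemma walk_last_hit D S K u v : walk D S u v ->
  walk D (S `\` K) u v \/ exists w, [/\ S w, K w & walk D (S `\` K) w v].
Proof.
elim=> {u v} [u v uv|u w v uw Sw wv [wv'|hit]]; first by left; exact: walk_edge.
  have [Kw|nKw] := pselect (K w); first by right; exists w.
  by left; exact: walk_step wv'.
by right.
Qed.

Lemma walk_of_dipath D (p : dipath V) : subdigraph p D -> 0 < plen p ->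
  walk D (pinner p) (pstart p) (pend p).
Proof.
move=> [_ sD] p0.
have E k : k < plen p -> edge D (p k, p k.+1) by move=> kp; apply: sD; exists k.
suff W d k : k + d.+1 = plen p -> walk D (pinner p) (p k) (pend p).
  by apply: (W (plen p).-1); rewrite add0n prednK.
elim: d k => [|d IH] k kd.
  by rewrite /pend -kd addn1; apply: walk_edge; apply: E; rewrite -kd addn1.
apply: (walk_step (w := p k.+1)); first by apply: E; lia.
  by exists k.+1 => //=; lia.
by apply: IH; lia.
Qed.

(** The path grows at its front; if the new first vertex already lies on it, only the part from that
    vertex on is kept. *)
Lemma dipath_of_walk D S u v : walk D S u v -> u <> v ->
  exists p : dipath V, [/\ subdigraph p D, pstart p = u, pend p = v & pinner p `<=` S].
Proof.
have edge_path (a b : V) : edge D (a, b) -> a <> b -> 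
    exists p : dipath V, [/\ subdigraph p D, pstart p = a, pend p = b & pinner p `<=` S].
  move=> ab anb.
  have inj k l : k <= 1 -> l <= 1 ->
      (if k == 0 then a else b) = (if l == 0 then a else b) -> k = l.
    by case: k l => [|[|k]] [|[|l]] //= _ _ // /esym.
  exists (Dipath inj); split=> //.
    have [Da Db] := edge_vert ab.
    split=> [_ [[|k] /= _ <-] //|_ [[|k] /= kl <-] //].
  by move=> _ [[|[|k]] /= kl <-].
elim=> {u v} [u v uv|u w v uw Sw _ IH] unv; first exact: edge_path.
have [wv|wnv] := pselect (w = v); first by subst w; exact: edge_path.
have [p [[sV sE] pw pv pS]] := IH wnv.
have [[k [kp pu]]|nu] := pselect (exists k, k <= plen p /\ p k = u).
  have inj i j : i <= plen p - k -> j <= plen p - k -> p (k + i) = p (k + j) -> i = j.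
    by move=> ip jp /pvtx_inj; lia.
  exists (Dipath inj); split.
  - split=> [_ [i /= ip <-]|_ [i /= ip <-]].
      by apply: sV; exists (k + i) => //=; lia.
    by apply: sE; exists (k + i); rewrite /= ?addnS //; lia.
  - by rewrite /pstart /= addn0.
  - by rewrite /pend /= subnKC.
  - by move=> _ [i /= ip <-]; apply: pS; exists (k + i) => //=; lia.
have inj i j : i <= (plen p).+1 -> j <= (plen p).+1 ->
    (if i is i'.+1 then p i' else u) = (if j is j'.+1 then p j' else u) -> i = j.
  case: i j => [|i] [|j] //= ip jp.
  - by move=> pj; case: nu; exists j.
  - by move=> pj; case: nu; exists i.
  - by move/pvtx_inj => ->.
have [Du Dw] := edge_vert uw.
exists (Dipath inj); split.
- split=> [_ [[|i] /= ip <-] //|_ [[|i] /= ip <-]].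
  + by apply: sV; exists i.
  + by rewrite -[p 0]/(pstart p) pw.
  + by apply: sE; exists i.
- by [].
- exact: pv.
move=> _ [[|[|i]] //= ip <-]; first by rewrite -[p 0]/(pstart p) pw.
by apply: pS; exists i.+1.
Qed.

End Walks.

Lemma finite_bounded T (m : T -> nat) (X : set T) : finite_set X ->
  exists M, forall x, X x -> m x <= M.
Proof.
move=> fX; have /finite_seqP[s sE] := finite_image m fX.
exists (\max_(i <- s) i) => x Xx; apply: leq_bigmax_seq => //.
have : (m @` X) (m x) by exists x.
by rewrite sE.
Qed.

Lemma finite_vert_dipath V (p : dipath V) : finite_set (vert p).
Proof.
apply: finite_image; apply: sub_finite_set (finite_II (plen p).+1) => k /=.
by rewrite ltnS.
Qed.

Section Necklaces.
Variable V : Type.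
Implicit Types (D N : digraph V) (X : set V).

Lemma witness_locally_finite N H X : necklace_witness N H -> finite_set X ->
  exists M, forall x l, X x -> M < l -> ~ vert (H l) x.
Proof.
move=> [_ [_ adj]] fX.
have /choice[m Hm] : forall x, exists m, forall l, m < l -> ~ vert (H l) x.
  move=> x; have [[l0 [l00 xl0]]|nx] := pselect (exists l, 0 < l /\ vert (H l) x).
    exists l0.+1 => l ll0 xl; have l_pos : pos l by rewrite /pos /=; lia.
    by have [/(_ (ex_intro _ x (conj xl0 xl))) [_ +] _] := adj _ _ l00 l_pos; lia.
  by exists 0 => l l0 xl; apply: nx; exists l.
have [M HM] := finite_bounded m fX.
by exists M => x l Xx Ml; apply: Hm; exact: leq_ltn_trans (HM _ Xx) Ml.
Qed.

Definition joined D S (u v : V) : Prop := u = v \/ walk D S u v.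

Lemma joined_trans D S u w v : S w -> joined D S u w -> joined D S w v -> joined D S u v.
Proof. by move=> Sw [->|uw] [<-|wv]; [left|right|right|right; exact: walk_cat wv]. Qed.

Lemma chain_joined N H a b D S : necklace_witness N H ->
  (forall m, a < m <= b -> edge (H m) `<=` edge D /\ vert (H m) `<=` S) ->
  forall m m' u v, a < m <= b -> a < m' <= b -> vert (H m) u -> vert (H m') v ->
  joined D S u v.
Proof.
move=> [HN [_ adj]] HS.
have step m : a < m <= b -> forall u v, vert (H m) u -> vert (H m) v -> joined D S u v.
  move=> mab u v mu mv; have m0 : pos m by rewrite /pos /=; lia.
  have [_ [_ /(_ u v mu mv)[p [[pV pE] [pu pv]]]]] := HN m m0.
  have [p0|p0] := posnP (plen p); first by left; rewrite -pu -pv /pend p0.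
  have [DH SH] := HS m mab.
  right; rewrite -pu -pv; apply: (walk_sub (D := D) (S := pinner p)) => //.
    by move=> _ [i /= ip <-]; apply: SH; apply: pV; exists i => //=; lia.
  apply: (walk_sub (D := H m) (S := pinner p)) => //.
  exact: (walk_of_dipath (conj pV pE)).
have chain d m : a < m -> m + d <= b -> forall u v, vert (H m) u -> vert (H (m + d)) v ->
    joined D S u v /\ joined D S v u.
  move=> am + u; elim: d => [|d IH] mdb v mu mv.
    by rewrite addn0 in mv mdb; split; apply: (step m) => //; lia.
  have [x [x1 x2]] : vert (H (m + d)) `&` vert (H (m + d.+1)) !=set0.
    by apply/adj; rewrite /pos /=; lia.
  have [|ux xu] := IH _ x mu x1; first by lia.
  have mdab : a < m + d.+1 <= b by lia.
  have Sx : S x by case: (HS _ mdab) => _; apply.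
  by split; [apply: joined_trans Sx ux _|apply: joined_trans Sx _ xu]; exact: (step (m + d.+1)).
move=> m m' u v mab m'ab mu m'v; have [mm'|/ltnW m'm] := leqP m m'.
  by have [] := chain (m' - m) m _ _ u v mu; rewrite ?subnKC //; lia.
by have [] := chain (m - m') m' _ _ v u m'v; rewrite ?subnKC //; lia.
Qed.

(** Let no block after the [M]-th meet [X]. Vertices outside [X] and the first [M] blocks lie in
    later blocks, and these form a strongly connected subgraph off [X]. This is what allows two
    links to be joined inside a necklace. *)
Lemma necklace_tail N X : necklace N -> finite_set X ->
  exists2 X', finite_set X' & X `<=` X' /\ forall w w', vert N w -> vert N w' ->
    ~ X' w -> ~ X' w' -> joined N (vert N `\` X) w w'.
Proof.
move=> [_ [H NH]] fX; have [M HM] := witness_locally_finite NH fX.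
have [Hl [NE adj]] := NH.
exists (X `|` \bigcup_(l in [set l | 0 < l <= M]) vert (H l)).
  rewrite finite_setU; split=> //; apply: bigcup_finite.
    by apply: sub_finite_set (finite_II M.+1) => l /= /andP[].
  by move=> l /= /andP[l0 _]; case: (Hl l l0) => _ [].
split=> [x Xx|w w']; first by left.
rewrite {1 2}NE => -[l /= l0 wl] [l' /= l'0 w'l'] /not_orP[_ nw] /not_orP[_ nw'].
have lM : M < l by rewrite ltnNge; apply/negP => lM; apply: nw; exists l => //=; apply/andP.
have l'M : M < l' by rewrite ltnNge; apply/negP => lM'; apply: nw'; exists l' => //=; apply/andP.
apply: (chain_joined NH (a := M) (b := maxn l l') _ _ _ wl w'l'); rewrite ?leq_maxl ?leq_maxr ?andbT //.
move=> k /andP[Mk _]; have k0 : pos k by rewrite /pos /=; lia.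
have [[sV sE] _] := Hl k k0.
by split=> // x xk; split; [exact: sV|move=> Xx; exact: HM xk].
Qed.

End Necklaces.

(** Avoiding an arbitrary finite set stands for having infinitely many disjoint paths. Adding [i]
    and [j] to [F] makes the walk meet [N i] and [N j] in its ends only. *)
Definition necklace_link V (D : digraph V) (N : nat -> digraph V) (F : set nat) (i j : nat) : Prop :=
  forall X, finite_set X -> exists u v,
    [/\ vert (N i) u, ~ X u, vert (N j) v, ~ X v &
        walk D (~` (X `|` \bigcup_(k in F `|` [set i; j]) vert (N k))) u v].

(** * Necklaces form a link system *)

Section NecklaceLinks.
Variables (V : Type) (D : digraph V) (N : nat -> digraph V).
Hypothesis ND : forall i, subdigraph (N i) D.
Hypothesis Nneck : forall i, necklace (N i).
Hypothesis Ndisj : forall i j x, vert (N i) x -> vert (N j) x -> i = j.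
Hypothesis Nequiv : forall i j, i <> j -> necklace_equiv D (N i) (N j).

Lemma necklace_link_system : link_system (necklace_link D N).
Proof.
split.
- move=> F G i j FG Gij X fX; have [u [v [iu Xu jv Xv uv]]] := Gij X fX.
  exists u, v; split=> //; apply: walk_sub uv => // x /not_orP[nX nG] [//|[k kF xk]].
  by apply: nG; exists k => //; case: kF => [/FG|]; [left|right].
- move=> F i j k Fij.
  have [|nij] := pselect (necklace_link D N (k |` F) i j); first by left.
  right; have /existsNP[X0 /not_implyP[fX0 nX0]] := nij.
  (* [X0] witnesses that the link fails once [N k] must be avoided, so a walk off [X] and [X0] meets
     [N k]; its parts up to the first and from the last vertex on [N k] serve the two new links. *)
  have hit X : finite_set X -> exists u v w w', [/\ vert (N i) u /\ ~ X u, vert (N j) v /\ ~ X v,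
      (vert (N k) w /\ ~ X w) /\ (vert (N k) w' /\ ~ X w'),
      walk D (~` (X `|` \bigcup_(m in k |` F `|` [set i; k]) vert (N m))) u w &
      walk D (~` (X `|` \bigcup_(m in k |` F `|` [set k; j]) vert (N m))) w' v].
    move=> fX; have fXX0 : finite_set (X `|` X0) by rewrite finite_setU.
    have [u [v [iu /not_orP[Xu X0u] jv /not_orP[Xv X0v] uv]]] := Fij _ fXX0.
    have sub (Y : set V) (G : set nat) : Y `<=` X `|` X0 -> G `<=` k |` (F `|` [set i; j]) ->
        ~` (X `|` X0 `|` \bigcup_(m in F `|` [set i; j]) vert (N m)) `\` vert (N k) `<=`
        ~` (Y `|` \bigcup_(m in G) vert (N m)).
      move=> YX GF x [/not_orP[nX nB] nK] [/YX //|[m /GF[-> //|Fm] mx]].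
      by apply: nB; exists m.
    case: (walk_first_hit (vert (N k)) uv) => [uv'|[w [Sw kw uw wv]]].
      case: nX0; exists u, v; split=> //; apply: walk_sub uv' => //.
      by apply: sub => [x|m /=]; [right|tauto].
    have [w' [Sw' kw' wv']] : exists w',
        [/\ (~` (X `|` X0 `|` \bigcup_(m in F `|` [set i; j]) vert (N m))) w', vert (N k) w' &
          walk D (~` (X `|` X0 `|` \bigcup_(m in F `|` [set i; j]) vert (N m)) `\` vert (N k)) w' v].
      by case: (walk_last_hit (vert (N k)) wv) => [wv'|[w' [? ? ?]]]; [exists w|exists w'].
    exists u, v, w, w'; split=> //.
    - by split; split=> // Xw; [apply: Sw|apply: Sw']; do 2 left.
    - by apply: walk_sub uw => //; apply: sub => [x|m /=]; [left|tauto].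
    - by apply: walk_sub wv' => //; apply: sub => [x|m /=]; [left|tauto].
  by split=> X /hit[u [v [w [w' [[iu Xu] [jv Xv] [[kw Xw] [kw' Xw']] uw wv]]]]];
    [exists u, w|exists w', v].
- move=> F i j k Fi Fj ij ik kj Fik Fkj X fX.
  (* [X'] is so large that the end of the first walk and the start of the second are joined inside
     [N k] off [X]. *)
  have [X' fX' [XX' tail]] := necklace_tail (Nneck k) fX.
  have [u [w [iu Xu kw Xw uw]]] := Fik _ fX'; have [w' [v [kw' Xw' jv Xv wv]]] := Fkj _ fX'.
  exists u, v; split=> //; try by move/XX'.
  have sub (G : set nat) : F `<=` G -> ~` (X' `|` \bigcup_(m in G) vert (N m)) `<=`
      ~` (X `|` \bigcup_(m in F `\ k `|` [set i; j]) vert (N m)).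
    move=> FG x nX [/XX' X'x|[m Fm mx]]; apply: nX; [by left|right; exists m => //].
    by apply: FG; case: Fm => [[]|[->|->]].
  have ksub : vert (N k) `\` X `<=` ~` (X `|` \bigcup_(m in F `\ k `|` [set i; j]) vert (N m)).
    move=> x [kx nX] [//|[m Fm mx]]; have := Ndisj kx mx.
    by case: Fm => [[_ /= mk]|[->|->]] => km; [case: mk|case: ik|case: kj].
  have Sk x : vert (N k) x -> ~ X' x -> (~` (X `|` \bigcup_(m in F `\ k `|` [set i; j]) vert (N m))) x.
    by move=> kx X'x; apply: ksub; split=> // /XX'.
  apply: (walk_cat (w := w)); [|exact: Sk|].
    by apply: walk_sub uw => //; apply: sub => m; left.
  have {}wv : walk D (~` (X `|` \bigcup_(m in F `\ k `|` [set i; j]) vert (N m))) w' v.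
    by apply: walk_sub wv => //; apply: sub => m; left.
  case: (tail w w' kw kw' Xw Xw') => [->//|ww'].
  apply: (walk_cat (w := w')); [|exact: Sk|by []].
  by apply: walk_sub ww' => //; case: (ND k).
- move=> i j ij X fX; have [[p [Hp dp]] _] := Nequiv ij.
  have /choice[m Hm] : forall x, exists m, forall n, vert (p n) x -> n = m.
    move=> x; have [[n nx]|no] := pselect (exists n, vert (p n) x).
      by exists n => n' n'x; apply: dp => //; exists x.
    by exists 0 => n nx; case: no; exists n.
  have [M HM] := finite_bounded m fX.
  have pX x : vert (p M.+1) x -> ~ X x by move=> /Hm px /HM; rewrite -px ltnn.
  have [sp [ip [jp inn]]] := Hp M.+1.
  exists (pstart (p M.+1)), (pend (p M.+1)); split=> //.
  + by apply: pX; exists 0.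
  + by apply: pX; exists (plen (p M.+1)) => /=.
  apply: (walk_sub (D := D)) (walk_of_dipath sp _) => //.
    move=> x px [|[k kij kx]].
      by apply: pX; case: px => k /= /andP[_ kp] <-; exists k => //=; exact: ltnW.
    suff : set0 x by [].
    by rewrite -inn; split=> //; case: kij => -[] kE; rewrite kE in kx; [left|right|left|right].
  rewrite lt0n; apply/eqP => p0; apply: ij; apply: (Ndisj ip).
  by move: jp; rewrite /pend p0.
Qed.

Lemma linking_path F i j X : i <> j -> finite_set X -> necklace_link D N F i j ->
  exists p : dipath V, [/\ subdigraph p D, vert (N i) (pstart p), vert (N j) (pend p),
    vert p `&` X = set0 & forall k, F k \/ k = i \/ k = j -> pinner p `&` vert (N k) = set0].
Proof.
move=> ij fX Fij; have [u [v [iu Xu jv Xv uv]]] := Fij X fX.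
have unv : u <> v by move=> uv'; subst v; exact: ij (Ndisj iu jv).
have [p [pD pu pv pS]] := dipath_of_walk uv unv.
exists p; split=> //; rewrite ?pu ?pv //.
  rewrite -subset0 => _ [[k /= kp <-] Xp].
  have [k0|k0] := posnP k; first by apply: Xu; rewrite -pu /pstart -k0.
  have [kE|kE] := eqVneq k (plen p); first by apply: Xv; rewrite -pv /pend -kE.
  by case: (pS (p k)); [exists k => //=; lia|left].
move=> k Fk; rewrite -subset0 => x [/pS /not_orP[_ nB] kx]; by apply: nB; exists k.
Qed.

End NecklaceLinks.

(** * Coarser witnesses *)

Section Coarsening.
Variables (V : Type) (N : digraph V) (H : nat -> digraph V) (c : nat -> nat).
Hypothesis NH : necklace_witness N H.
Hypothesis c0 : c 0 = 0.
Hypothesis c_incr : forall l, c l < c l.+1.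

(** The conditions on odd and even blocks will be met by merging consecutive blocks of a given
    witness, with cut points [c] adapted to the ends of the horizontal paths. *)
Definition coarsen (l : nat) : digraph V := bigdU [set m | c l.-1 < m <= c l] H.

Let c_mono l k : l <= k -> c l <= c k.
Proof.
elim: k => [|k IH]; first by rewrite leqn0 => /eqP ->.
by rewrite leq_eqVlt => /orP[/eqP -> //|/IH lk]; apply: leq_trans lk (ltnW (c_incr k)).
Qed.

(** Consecutive merged blocks meet where [H (c l)] meets its successor; between two non-consecutive
    ones lies a whole merged block, so their old indices differ by more than one. *)
Lemma coarsen_witness : necklace_witness N coarsen.
Proof.
have [HN [NE adj]] := NH.
have block_pos l m : c l.-1 < m <= c l -> pos m by rewrite /pos /=; lia.
have block_last l : pos l -> c l.-1 < c l <= c l by case: l => //= l _; rewrite c_incr leqnn.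
have block_ex m : pos m -> exists2 l, pos l & c l.-1 < m <= c l.
  move=> m0; have ex : exists l, m <= c l.
    by exists m; elim: (m) => // k IH; apply: leq_ltn_trans IH (c_incr k).
  have [l ml lmin] := ex_minnP ex; have l0 : pos l.
    by case: l ml {lmin} => //; rewrite c0; move: m0; rewrite /pos /=; lia.
  exists l; rewrite // ml andbT ltnNge; apply/negP => /lmin; move: l0; rewrite /pos /=; lia.
split; [|split].
- move=> l l0; split; [|split].
  + split=> [x [m /block_pos m0 mx]|e [m /block_pos m0 me]].
      by case: (HN m m0) => -[+ _] _; apply.
    by case: (HN m m0) => -[_ +] _; apply.
  + apply: bigcup_finite; last by move=> m /block_pos /HN [_ []].
    by apply: sub_finite_set (finite_II (c l).+1) => m /= /andP[_]; rewrite ltnS.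
  + move=> u v [m ml mu] [m' m'l m'v].
    have [uv|uv] := pselect (u = v).
      subst v; have inj k k' : k <= 0 -> k' <= 0 -> u = u -> k = k' by lia.
      exists (Dipath inj); split=> //; split=> [_ [k _ <-]|_ [k //]].
      by exists m.
    have [|//|muv] := @chain_joined _ N H (c l.-1) (c l) (coarsen l) setT NH _ m m' u v ml m'l mu m'v.
      by move=> k kl; split=> // e ke; exists k.
    by have [p [? ? ? _]] := dipath_of_walk muv uv; exists p.
- rewrite NE; apply: digraph_eq; apply/seteqP; split=> x /=.
  + by case=> m /block_ex[l l0 ml] mx; exists l => //; exists m.
  + by case=> l _ [m /block_pos m0 mx]; exists m.
  + by case=> m /block_ex[l l0 ml] mx; exists l => //; exists m.
  + by case=> l _ [m /block_pos m0 mx]; exists m.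
move=> l k l0 k0; split.
  move=> [x [[m ml mx] [m' m'k m'x]]].
  have [/(_ (ex_intro _ x (conj mx m'x))) [mm' m'm] _] :=
    adj m m' (block_pos _ _ ml) (block_pos _ _ m'k).
  have far a b n n' : c a.-1 < n <= c a -> c b.-1 < n' <= c b -> b.+1 < a -> n'.+1 < n.
    move=> na n'b ba; have := c_mono (l := b.+1) (k := a.-1); have := c_incr b; lia.
  split; rewrite leqNgt; apply/negP => ?.
    by have := far l k m m' ml m'k; lia.
  by have := far k l m' m m'k ml; lia.
have meet a : pos a -> vert (coarsen a) `&` vert (coarsen a.+1) !=set0.
  move=> a0; have ca : pos (c a) by apply: (block_pos a); exact: block_last.
  have [x [xa xa1]] : vert (H (c a)) `&` vert (H (c a).+1) !=set0 by apply/adj => //; lia.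
  exists x; split; [exists (c a); [exact: block_last|by []]|exists (c a).+1 => //=].
  by rewrite leqnn c_incr.
move=> [lk kl]; have [E|[E|E]] : l = k \/ l = k.+1 \/ k = l.+1 by lia.
- by subst l; have [x [? _]] := meet k k0; exists x.
- by subst l; have [x [? ?]] := meet k k0; exists x.
- by subst k; exact: meet.
Qed.

End Coarsening.

(** * Quarter-grids traced by an infinite tour of the rays *)

Section RayWalk.
Variable c : nat -> nat.
Fixpoint visits (i t : nat) : nat := if t is t'.+1 then visits i t' + (c t' == i) else 0.

(* At time [t] the tour arrives on ray [c t] at [wvtx t.*2] and leaves it from [wvtx t.*2.+1]; the
   second component is the position on that ray. *)
Definition wvtx (k : nat) : nat * nat := (c k./2, (visits (c k./2) k./2).*2.+1 + odd k).

Lemma visits_leq i t t' : t <= t' -> visits i t <= visits i t'.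
Proof.
elim: t' => [|t' IH]; first by rewrite leqn0 => /eqP ->.
by rewrite leq_eqVlt => /orP[/eqP -> //|/IH le] /=; apply: leq_trans le (leq_addr _ _).
Qed.

Lemma visits_lt t t' : t < t' -> visits (c t) t < visits (c t) t'.
Proof. by move=> tt'; apply: leq_trans (visits_leq (c t) tt'); rewrite /= eqxx addn1. Qed.

Lemma wvtx_mono k k' : k < k' -> (wvtx k).1 = (wvtx k').1 -> (wvtx k).2 < (wvtx k').2.
Proof.
move=> kk' /= cE; have [lt|ge] := ltnP k./2 k'./2.
  by rewrite -cE; have := visits_lt lt; lia.
have E : k./2 = k'./2 by lia.
by rewrite -E; lia.
Qed.

Lemma wvtx_le k k' : (wvtx k).1 = (wvtx k').1 -> (wvtx k).2 <= (wvtx k').2 -> k <= k'.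
Proof.
move=> cE le; rewrite leqNgt; apply/negP => /wvtx_mono lt.
by have := lt (esym cE); rewrite ltnNge le.
Qed.

Lemma wvtx_inj : injective wvtx.
Proof. by move=> k k' E; apply/eqP; rewrite eqn_leq; apply/andP; split; apply: wvtx_le; rewrite E. Qed.

(** Position [m] belongs to visit number [v = m.-1./2] of ray [i], counted from 0, and the parity of
    [m.-1] tells arrival from departure. The visit takes place just before [visits i] first exceeds
    [v]. *)
Lemma wvtx_surj i m : (forall T, exists2 t, T <= t & c t = i) -> 0 < m ->
  exists k, wvtx k = (i, m).
Proof.
move=> c_inf m0; pose v := m.-1./2.
have many : exists T, v < visits i T.
  elim: v => [|v [T vT]]; first by have [t _ ti] := c_inf 0; exists t.+1; rewrite /= ti eqxx addn1.
  by have [t Tt ti] := c_inf T; exists t.+1; have := visits_leq i Tt; rewrite /= ti eqxx; lia.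
have [[//|t] /= vt tmin] := ex_minnP many.
have le : visits i t <= v by rewrite leqNgt; apply/negP => /tmin; rewrite ltnn.
have [ti vE] : c t = i /\ visits i t = v.
  by have [cti|] := eqVneq (c t) i; move: vt; [lia|case: eqP => // _; lia].
exists (t.*2 + odd m.-1); rewrite /wvtx.
have -> : (t.*2 + odd m.-1)./2 = t by lia.
rewrite ti vE; congr pair; rewrite /v; lia.
Qed.

Lemma ray_vtx_inj i : injective (fun k : nat => (i, k + (i == 1))).
Proof. by move=> k l [] /addIn. Qed.

(* The tour starts at [wvtx 0 = (1, 1)], which is the root of ray 1 and lies on no girder; the root
   of any other ray [i] is [(i, 0)]. *)
Definition grid_ray (i : nat) : outray (nat * nat) := Outray (@ray_vtx_inj i).

Lemma grid_ray_fst i x : vert (grid_ray i) x -> x.1 = i.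
Proof. by case=> k _ <-. Qed.

Lemma wvtx_on_ray k : vert (grid_ray (c k./2)) (wvtx k).
Proof.
exists ((wvtx k).2 - (c k./2 == 1)) => //; rewrite /= subnK // /wvtx /=.
by case: (_ == 1) => //; lia.
Qed.

Lemma wvtx_ray_edge t : edge (grid_ray (c t)) (wvtx t.*2, wvtx t.*2.+1).
Proof.
exists ((wvtx t.*2).2 - (c t == 1)) => //=; congr pair.
  by rewrite /wvtx /= doubleK odd_double subnK //; case: (_ == 1); lia.
by rewrite /wvtx /= doubleK uphalf_double odd_double; congr pair; case: (_ == 1); lia.
Qed.

Lemma wseg_inj a p k l : k <= p -> l <= p -> wvtx (a + k) = wvtx (a + l) -> k = l.
Proof. by move=> _ _ /wvtx_inj /addnI. Qed.

Definition wseg (a p : nat) : dipath (nat * nat) := Dipath (@wseg_inj a p).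

Lemma wseg_vert a p x : vert (wseg a p) x <-> exists2 k, a <= k <= a + p & x = wvtx k.
Proof.
split=> [[k /= kp <-]|[k kp ->]]; first by exists (a + k) => //; lia.
by exists (k - a) => /=; [lia|congr wvtx; lia].
Qed.

Lemma wseg_edge a p e : edge (wseg a p) e <->
  exists2 k, a <= k < a + p & e = (wvtx k, wvtx k.+1).
Proof.
split=> [[k /= kp <-]|[k kp ->]]; first by exists (a + k); rewrite ?addnS //; lia.
by exists (k - a) => /=; [lia|congr pair; congr wvtx; lia].
Qed.

Lemma wseg1 a : path_graph (wseg a 1) = edge_graph (wvtx a) (wvtx a.+1).
Proof.
apply: digraph_eq; apply/seteqP; split=> x /=.
- by case/wseg_vert => k kE ->; have [->|->] : k = a \/ k = a.+1 by [lia]; [left|right].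
- by case=> ->; apply/wseg_vert; [exists a|exists a.+1] => //; lia.
- by case/wseg_edge => k kE ->; have -> : k = a by lia.
- by move=> ->; apply/wseg_edge; exists a => //; lia.
Qed.

Lemma wseg_cat a p q : path_graph (wseg a (p + q.+1)) =
  dU (dU (wseg a p) (edge_graph (wvtx (a + p)) (wvtx (a + p).+1))) (wseg (a + p).+1 q).
Proof.
apply: digraph_eq; apply/seteqP; split=> x.
- case/wseg_vert => k kE ->; have [kp|pk] := leqP k (a + p).
    by left; left; apply/wseg_vert; exists k => //; lia.
  by right; apply/wseg_vert; exists k => //; lia.
- case=> [[/wseg_vert[k kE ->]|[->|->]]|/wseg_vert[k kE ->]]; apply/wseg_vert.
  + by exists k => //; lia.
  + by exists (a + p) => //; lia.
  + by exists (a + p).+1 => //; lia.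
  + by exists k => //; lia.
- case/wseg_edge => k kE ->; have [kp|pk|kp] := ltngtP k (a + p).
  + by left; left; apply/wseg_edge; exists k => //; lia.
  + by right; apply/wseg_edge; exists k => //; lia.
  + by left; right; rewrite kp.
- case=> [[/wseg_edge[k kE ->]|->]|/wseg_edge[k kE ->]]; apply/wseg_edge.
  + by exists k => //; lia.
  + by exists (a + p) => //; lia.
  + by exists k => //; lia.
Qed.

(** On every ray the tour only moves forward, so its later parts avoid the closure of the earlier
    ones. All avoidance conditions of quarter-grids come from this. *)
Lemma wseg_avoids_closure a p b q : b + q < a ->
  vert (wseg a p) `&` dclosure grid_ray (vert (wseg b q)) = set0.
Proof.
move=> ba; rewrite -subset0 => x [/wseg_vert[k kE ->] [/wseg_vert[l lE]|]].
  by move/wvtx_inj => kl; lia.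
case=> i [m [n [i0 [mn [wE /wseg_vert[l lE wl]]]]]].
have : k <= l; last by lia.
by apply: wvtx_le; rewrite wE -wl //= leq_add2r.
Qed.

End RayWalk.

(* Girder [n] traverses the rays [cyc n 0, cyc n 1, ..., cyc n (L n)] in this order. *)
Record schedule (L : nat -> nat) (cyc : nat -> nat -> nat) : Prop := {
  sched_pos : forall n, 2 <= n -> 0 < L n;
  sched_first : forall n, 2 <= n -> cyc n 0 = 1;
  sched_last : forall n, 2 <= n -> cyc n (L n) = 1;
  sched_bound : forall n j, 2 <= n -> j <= L n -> 0 < cyc n j <= n;
  sched_turn : forall n j, 2 <= n -> j < L n -> cyc n j <> cyc n j.+1;
  sched_all : forall n i, 2 <= n -> 0 < i <= n -> exists2 j, j < L n & cyc n j = i }.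

Section Schedule.
Variables (L : nat -> nat) (cyc : nat -> nat -> nat).
Hypothesis Hs : schedule L cyc.

Definition start (n : nat) : nat := \sum_(2 <= m < n) L m.

(** The value [(n, j)] stands for stop [j] of girder [n]. The final stop [L n] does not occur: it is
    on ray 1 and counts as stop 0 of girder [n.+1]. *)
Fixpoint stage (t : nat) : nat * nat :=
  if t is t'.+1 then
    let: (n, j) := stage t' in if j.+1 < L n then (n, j.+1) else (n.+1, 0)
  else (2, 0).

Definition tour (t : nat) : nat := cyc (stage t).1 (stage t).2.

Lemma startS n : 2 <= n -> start n.+1 = start n + L n.
Proof. by move=> n2; rewrite /start big_nat_recr. Qed.

Lemma start_leq n m : 2 <= n -> n < m -> start n + L n <= start m.
Proof.
move=> n2; elim: m => // m IH; rewrite ltnS leq_eqVlt => /orP[/eqP <-|nm].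
  by rewrite startS.
by rewrite startS; [apply: leq_trans (IH nm) (leq_addr _ _)|lia].
Qed.

Lemma stage_spec t : [/\ 2 <= (stage t).1, (stage t).2 < L (stage t).1 &
  t = start (stage t).1 + (stage t).2].
Proof.
elim: t => [|t /=]; first by rewrite /start big_geq; split=> //; exact: (sched_pos Hs).
case: (stage t) => n j /= [n2 jn tE]; case: ifPn => [jL|/=]; first by split=> //=; lia.
move=> jL; split; [lia| |].
  by apply: (sched_pos Hs); lia.
by rewrite startS //; lia.
Qed.

Lemma stage_start n j : 2 <= n -> j < L n -> stage (start n + j) = (n, j).
Proof.
move=> n2 jn; have := stage_spec (start n + j); case: (stage _) => m k /= [m2 km E].
have [nm|mn|nm] := ltngtP n m.
- by have := start_leq n2 nm; lia.
- by have := start_leq m2 mn; lia.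
- by subst m; congr pair; lia.
Qed.

Lemma tour_start n j : 2 <= n -> j <= L n -> tour (start n + j) = cyc n j.
Proof.
move=> n2; rewrite leq_eqVlt => /orP[/eqP ->|jn]; last by rewrite /tour stage_start.
rewrite -startS // -[start n.+1]addn0 /tour stage_start; try by lia.
  by rewrite /= (sched_last Hs) // (sched_first Hs) //; lia.
by apply: (sched_pos Hs); lia.
Qed.

Lemma tour_stage t : exists n j, [/\ 2 <= n, j < L n, t = start n + j,
  tour t = cyc n j & tour t.+1 = cyc n j.+1].
Proof.
have [n2 jn tE] := stage_spec t; exists (stage t).1, (stage t).2; split=> //.
by rewrite {1}tE -addnS tour_start.
Qed.

Lemma tour0 : tour 0 = 1. Proof. by rewrite /tour /= (sched_first Hs). Qed.

Lemma tour_pos t : 0 < tour t.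
Proof.
have [n [j [n2 jn _ -> _]]] := tour_stage t.
by have /andP[] := sched_bound Hs n2 (ltnW jn).
Qed.

Lemma tour_turn t : tour t <> tour t.+1.
Proof. by have [n [j [n2 jn _ -> ->]]] := tour_stage t; exact: (sched_turn Hs). Qed.

Lemma start_ge n : n.+2 <= start n.+2 + 2.
Proof.
elim: n => [|n IH]; first lia.
by rewrite startS //; have := sched_pos Hs (n := n.+2) isT; lia.
Qed.

Lemma tour_inf i T : 0 < i -> exists2 t, T <= t & tour t = i.
Proof.
move=> i0; have [n [n2 ni Tn]] : exists n, [/\ 2 <= n, i <= n & T <= start n].
  by exists (maxn i T).+2; have := start_ge (maxn i T); split; lia.
have [|j jn ji] := sched_all Hs (n := n) (i := i) n2; first by rewrite i0.
exists (start n + j); first by lia.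
by rewrite tour_start // ltnW.
Qed.

Notation W := (nat * nat)%type.
Notation z := (wvtx tour).

(** Runs from the departure from ray 1 at time [start n] to the arrival on ray 1 at time
    [start n + L n]. The edge of ray 1 from there to the next departure lies in no girder, which
    keeps the girders disjoint. *)
Definition girder (n : nat) : dipath W := wseg tour (start n).*2.+1 (L n).*2.-1.

Definition tour_grid : digraph W :=
  dU (bigdU pos (fun i => grid_ray i : digraph W))
     (bigdU [set n | 2 <= n] (fun n => girder n : digraph W)).

Lemma girder_vert n x : 2 <= n -> vert (girder n) x ->
  exists2 k, (start n).*2 < k <= (start n.+1).*2 & x = z k.
Proof.
move=> n2 /wseg_vert[k kE ->]; exists k => //; rewrite startS //.
by have := sched_pos Hs n2; lia.
Qed.

Lemma crossing_in_girder t : exists2 n, 2 <= n & edge (girder n) (z t.*2.+1, z t.*2.+2).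
Proof.
have [n [j [n2 jn tE _ _]]] := tour_stage t; exists n => //.
by apply/wseg_edge; exists t.*2.+1 => //; have := sched_pos Hs n2; lia.
Qed.

Lemma on_grid_ray_tour k : vert (grid_ray (tour k./2)) (z k).
Proof. exact: wvtx_on_ray. Qed.

Lemma grid_ray_unique i j x : vert (grid_ray i) x -> vert (grid_ray j) x -> i = j.
Proof. by move=> /grid_ray_fst <- /grid_ray_fst <-. Qed.

Lemma girder_edgeP n e : edge (girder n) e ->
  (exists t, e = (z t.*2.+1, z t.*2.+2)) \/ exists t, edge (grid_ray (tour t)) e.
Proof.
case/wseg_edge => k _ ->; have [ok|ek] := boolP (odd k); [left|right]; exists k./2.
  by have <- : k = k./2.*2.+1 by lia.
have := @wvtx_ray_edge tour k./2; have -> // : k./2.*2 = k by lia.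
Qed.

Lemma half_doubleS t : t.*2.+1./2 = t. Proof. by lia. Qed.
Lemma half_doubleSS t : t.*2.+2./2 = t.+1. Proof. by lia. Qed.

Lemma horizontalP i j e : horizontal grid_ray tour_grid i j e <->
  exists t, [/\ i = tour t, j = tour t.+1 & e = (z t.*2.+1, z t.*2.+2)].
Proof.
split=> [[_ [_ [ij [eQ [ei ej]]]]]|[t [-> -> ->]]].
  have noray m : edge (grid_ray m) e -> False.
    by move=> /edge_vert[m1 m2]; apply: ij; rewrite (grid_ray_unique ei m1) (grid_ray_unique ej m2).
  case: eQ => [[m _ /noray //]|[n /= n2 /girder_edgeP[[t tE]|[t /noray //]]]].
  exists t; subst e; split=> //.
    by rewrite (grid_ray_unique ei (on_grid_ray_tour _)) half_doubleS.
  by rewrite (grid_ray_unique ej (on_grid_ray_tour _)) half_doubleSS.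
split; first exact: tour_pos.
split; first exact: tour_pos.
split; first exact: tour_turn.
split; first by right; have [n n2 ne] := crossing_in_girder t; exists n.
split; first by have := on_grid_ray_tour t.*2.+1; rewrite half_doubleS.
by have := on_grid_ray_tour t.*2.+2; rewrite half_doubleSS.
Qed.

Lemma horizontal_edgesP e : horizontal_edges grid_ray tour_grid e <->
  exists t, e = (z t.*2.+1, z t.*2.+2).
Proof.
split=> [[i [j /horizontalP[t [_ _ ->]]]]|[t ->]]; first by exists t.
by exists (tour t), (tour t.+1); apply/horizontalP; exists t.
Qed.

Lemma grid_ray_vtx_surj i k : 0 < i -> exists l, z l = grid_ray i k.+1 /\ (0 < l) .
Proof.
move=> i0; have [||l lE] := @wvtx_surj tour i (k.+1 + (i == 1)); [|by []|].
  by move=> T; exact: tour_inf.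
exists l; split=> //; rewrite lt0n; apply/eqP => l0; subst l.
by move: lE; rewrite /wvtx /= tour0 => -[<-]; rewrite eqxx; lia.
Qed.

(** As for degrees, a root has no incoming edge, and any other ray vertex is a point [z l] of the
    tour with [l > 0]: a departure has a second outgoing edge, an arrival a second incoming one,
    each on a girder. *)
Lemma tour_quarter_grid (gird : (nat -> outray W) -> nat -> digraph W -> Prop) :
  (forall n, 2 <= n -> gird grid_ray n (girder n)) -> quarter_grid gird grid_ray tour_grid.
Proof.
move=> Hg.
have root i n : 2 <= n -> ~ vert (girder n) (grid_ray i 0).
  move=> n2 /(girder_vert n2)[k kE zE].
  case: (i =P 1) zE => [->|i1] zE.
    have : z 0 = z k by rewrite -zE /wvtx /= tour0.
    by move/wvtx_inj; lia.
  by move/(congr1 snd): zE => /=; case: eqP => // _; lia.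
split; first by move=> i j _ _ [x [xi xj]]; exact: grid_ray_unique xi xj.
exists (fun n => girder n : digraph W); split=> //; split; [|split=> //; split].
- move=> i n i2 ni; apply: wseg_avoids_closure.
  have := start_leq i2 ni; have := sched_pos Hs i2; lia.
- move=> v vQ [[u [uv uuniq]] [w [vw wuniq]]].
  have [i [k [i0 vE]]] : exists i k, 0 < i /\ v = grid_ray i k.
    case: vQ => [[i i0 [k _ <-]]|[n n2 /(girder_vert n2)[l _ ->]]]; first by exists i, k.
    by have [k _ <-] := on_grid_ray_tour l; exists (tour l./2), k; split=> //; exact: tour_pos.
  subst v; have ray_edge j m : 0 < j -> edge tour_grid (grid_ray j m, grid_ray j m.+1).
    by move=> j0; left; exists j => //; exists m.
  case: k vQ uv vw uuniq wuniq => [|k] vQ uv vw uuniq wuniq.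
    case: uv => [[j j0 [m _ [_ ji jE]]]|[n n2 /edge_vert[_ /(root i n n2)] //]].
    by subst j; move/addIn: jE.
  have [l [lE l0]] := grid_ray_vtx_surj k i0.
  have li : tour l./2 = i by move/(congr1 fst): lE.
  have [ol|el] := boolP (odd l).
    have [n n2 ne] := crossing_in_girder l./2.
    have l2 : l./2.*2.+1 = l by lia.
    have out : edge tour_grid (grid_ray i k.+1, z l.+1).
      by right; exists n => //; rewrite -lE -{1}l2 -[in X in (_, z X)]l2.
    have := wuniq _ out; rewrite (wuniq _ (ray_edge i k.+1 i0)) => /(congr1 fst) /=.
    by rewrite -li; have := @tour_turn l./2; have -> : uphalf l = l./2.+1 by lia.
  have [n n2 ne] := crossing_in_girder l.-1./2.
  have l2 : l.-1./2.*2.+1 = l.-1 by lia.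
  have l3 : l.-1./2.*2.+2 = l by lia.
  have in_ : edge tour_grid (z l.-1, grid_ray i k.+1).
    by right; exists n => //; rewrite -lE -l2 -[in X in (_, z X)]l3.
  have := uuniq _ in_; rewrite (uuniq _ (ray_edge i k i0)) => /(congr1 fst)/esym /=.
  by rewrite -li; have := @tour_turn l.-1./2; have -> : l./2 = l.-1./2.+1 by lia.
- by move=> i n _; exact: root.
Qed.
End Schedule.

(** The stops of girder [n] are [1, 2, ..., n, ..., 2, 1] here, [1, 2, ..., n, 1] for [asc_cyc] and
    [1, n, ..., 2, 1] for [desc_cyc]. *)
Definition bi_cyc (n j : nat) : nat := if j < n then j.+1 else n.*2.-1 - j.
Definition asc_cyc (n j : nat) : nat := if j < n then j.+1 else 1.
Definition desc_cyc (n j : nat) : nat := if j == 0 then 1 else n.+1 - j.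

Lemma bi_schedule : schedule (fun n => n.-1.*2) bi_cyc.
Proof.
rewrite /bi_cyc; split.
- by lia.
- by move=> n n2; case: ifP => //; lia.
- by move=> n n2; case: ifP; lia.
- by move=> n j n2 jn; case: ifP; lia.
- by move=> n j n2 jn; case: ifP; case: ifP; lia.
- by move=> n i n2 /andP[i0 iN]; exists i.-1; [lia|case: ifP; lia].
Qed.

Lemma asc_schedule : schedule id asc_cyc.
Proof.
rewrite /asc_cyc; split.
- by lia.
- by move=> n n2; case: ifP => //; lia.
- by move=> n n2; case: ifP; lia.
- by move=> n j n2 jn; case: ifP; lia.
- by move=> n j n2 jn; case: ifP; case: ifP; lia.
- by move=> n i n2 /andP[i0 iN]; exists i.-1; [lia|case: ifP; lia].
Qed.

Lemma desc_schedule : schedule id desc_cyc.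
Proof.
rewrite /desc_cyc; split.
- by lia.
- by [].
- by move=> n n2; case: eqP; lia.
- by move=> n j n2 jn; case: eqP; lia.
- by move=> n j n2 jn; case: eqP; case: eqP; lia.
- move=> n i n2 /andP[i0 iN]; have [->|i1] := eqVneq i 1; first by exists 0; [lia|].
  by exists (n.+1 - i); [lia|case: eqP; lia].
Qed.

(** * The three quarter-grids *)

Section Staircases.
Variables (c : nat -> nat) (s : seq nat) (t : nat).

Lemma wseg_staircase p : p.+1 = (size s).-1.*2 -> 
  (forall j, j < size s -> nth 0 s j = c (t + j)) ->
  simple_staircase grid_ray s (wseg c t.*2.+1 p).
Proof.
move=> ps sc; split; [by []|split] => j js.
  rewrite !sc; try lia.
  have := wvtx_on_ray c (t.*2.+1 + j.*2); have := wvtx_on_ray c (t.*2.+1 + j.*2.+1).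
  have -> : (t.*2.+1 + j.*2)./2 = t + j by lia.
  by have -> : (t.*2.+1 + j.*2.+1)./2 = t + j.+1 by lia.
rewrite sc; last by lia.
have := wvtx_ray_edge c (t + j.+1) => /=.
have -> : t.*2.+1 + j.*2.+1 = (t + j.+1).*2 by lia.
by have -> : t.*2.+1 + j.*2.+2 = (t + j.+1).*2.+1 by lia.
Qed.

End Staircases.

Lemma nth_up_seq n j : j < n -> nth 0 (up_seq n) j = j.+1.
Proof. by move=> jn; rewrite nth_iota. Qed.

Lemma nth_down_seq n j : j < n -> nth 0 (down_seq n) j = n - j.
Proof. by move=> jn; rewrite nth_rev size_iota // nth_iota; lia. Qed.

Lemma bi_quarter_grid :
  bidirected_quarter_grid grid_ray (tour_grid (fun n => n.-1.*2) bi_cyc).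
Proof.
apply: (tour_quarter_grid bi_schedule) => n n2.
pose c := tour (fun n => n.-1.*2) bi_cyc; pose t := start (fun n => n.-1.*2) n.
have ct j : j <= n.-1.*2 -> c (t + j) = bi_cyc n j by move=> jn; apply: (tour_start bi_schedule).
exists (wseg c t.*2.+1 n.-1.*2.-1), (wseg c (t + n.-1).*2.+1 n.-1.*2.-1).
split.
  apply: wseg_staircase; first by rewrite size_iota; lia.
  move=> j; rewrite size_iota => jn; rewrite nth_up_seq // ct; last by lia.
  by rewrite /bi_cyc jn.
split.
  apply: wseg_staircase; first by rewrite size_rev size_iota; lia.
  move=> j; rewrite size_rev size_iota => jn; rewrite nth_down_seq // -addnA ct; last by lia.
  by rewrite /bi_cyc; case: ifP; lia.
split.
  have := wvtx_ray_edge c (t + n.-1); rewrite ct; last by lia.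
  have -> : bi_cyc n n.-1 = n by rewrite /bi_cyc; case: ifP; lia.
  rewrite /pend /pstart /= addn0.
  by have -> : t.*2.+1 + n.-1.*2.-1 = (t + n.-1).*2 by lia.
split; first by apply: wseg_avoids_closure; lia.
rewrite /girder -/t -/c.
have -> : n.-1.*2.*2.-1 = n.-1.*2.-1 + n.-1.*2.-1.+1 by lia.
rewrite wseg_cat /pend /pstart /= addn0.
by have -> : (t.*2.+1 + n.-1.*2.-1).+1 = (t + n.-1).*2.+1 by lia.
Qed.

Lemma asc_quarter_grid :
  ascending_cyclic_quarter_grid grid_ray (tour_grid id asc_cyc).
Proof.
apply: (tour_quarter_grid asc_schedule) => n n2.
pose c := tour id asc_cyc; pose t := start id n.
have ct j : j <= n -> c (t + j) = asc_cyc n j by move=> jn; apply: (tour_start asc_schedule).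
exists (wseg c t.*2.+1 n.-1.*2.-1), (wvtx c (t + n.-1).*2.+1), (wvtx c (t + n.-1).*2.+2).
split.
  apply: wseg_staircase; first by rewrite size_iota; lia.
  move=> j; rewrite size_iota => jn; rewrite nth_up_seq // ct; last by lia.
  by rewrite /asc_cyc jn.
have cn : asc_cyc n n.-1 = n by rewrite /asc_cyc; case: ifP; lia.
split.
  have := wvtx_on_ray c (t + n.-1).*2.+1.
  have -> : (t + n.-1).*2.+1./2 = t + n.-1 by lia.
  by rewrite ct ?cn; last by lia.
split.
  have := wvtx_on_ray c (t + n.-1).*2.+2.
  have -> : (t + n.-1).*2.+2./2 = t + n by lia.
  by rewrite ct // /asc_cyc ltnn.
split.
  have := wvtx_ray_edge c (t + n.-1); rewrite ct ?cn; last by lia.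
  rewrite /pend /=.
  by have -> : t.*2.+1 + n.-1.*2.-1 = (t + n.-1).*2 by lia.
split; first by rewrite -wseg1; apply: wseg_avoids_closure; lia.
rewrite /girder -/t -/c.
have -> : n.*2.-1 = n.-1.*2.-1 + 2 by lia.
rewrite wseg_cat wseg1 /pend /=.
by have -> : (t.*2.+1 + n.-1.*2.-1).+1 = (t + n.-1).*2.+1 by lia.
Qed.

Lemma desc_quarter_grid :
  descending_cyclic_quarter_grid grid_ray (tour_grid id desc_cyc).
Proof.
apply: (tour_quarter_grid desc_schedule) => n n2.
pose c := tour id desc_cyc; pose t := start id n.
have ct j : j <= n -> c (t + j) = desc_cyc n j by move=> jn; apply: (tour_start desc_schedule).
exists (wseg c t.+1.*2.+1 n.-1.*2.-1), (wvtx c t.*2.+1), (wvtx c t.*2.+2).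
split.
  apply: wseg_staircase; first by rewrite size_rev size_iota; lia.
  move=> j; rewrite size_rev size_iota => jn; rewrite nth_down_seq // addSnnS ct; last by lia.
  by rewrite /desc_cyc /=; lia.
split.
  have := wvtx_on_ray c t.*2.+1.
  have -> : t.*2.+1./2 = t + 0 by lia.
  by rewrite ct.
split.
  have := wvtx_on_ray c t.*2.+2.
  have -> : t.*2.+2./2 = t + 1 by lia.
  by rewrite ct /desc_cyc /= ?subn1; last by lia.
split.
  have := wvtx_ray_edge c (t + 1); rewrite ct; last by lia.
  rewrite /pstart /= addn0 /desc_cyc /= subn1 /=.
  have -> : t.+1.*2.+1 = (t + 1).*2.+1 by lia.
  by have -> : t.*2.+2 = (t + 1).*2 by lia.
split; first by rewrite -wseg1; apply: wseg_avoids_closure; lia.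
rewrite /girder -/t -/c.
have -> : n.*2.-1 = 1 + n.-1.*2.-1.+1 by lia.
rewrite wseg_cat wseg1 /pstart /= addn0.
have -> : (t.*2.+1 + 1) = t.*2.+2 by lia.
by have -> : t.+1.*2.+1 = t.*2.+3 by lia.
Qed.

(** * Routing the girders through the necklaces *)

Definition upd T (f : nat -> T) (t : nat) (x : T) : nat -> T :=
  fun k => if k == t then x else f k.

(** Recursive choice with access to the whole history: [P t] depends on no value after [t], so later
    updates leave it intact; [x0] fills the values not yet chosen. *)
Lemma history_choice T (x0 : T) (P : nat -> (nat -> T) -> Prop) :
  (forall t f f', (forall k, k <= t -> f k = f' k) -> P t f -> P t f') ->
  (forall t f, (forall k, k < t -> P k f) -> exists x, P t (upd f t x)) ->
  exists f, forall t, P t f.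
Proof.
move=> ext step.
have /choice[F HF] : forall q : nat * (nat -> T), exists x,
    (forall k, k < q.1 -> P k q.2) -> P q.1 (upd q.2 q.1 x).
  move=> [t f] /=; have [/step[x Px]|nP] := pselect (forall k, k < t -> P k f).
    by exists x.
  by exists x0.
pose g := fix g t := if t is t'.+1 then upd (g t') t' (F (t', g t')) else fun=> x0.
have gE t k : k < t -> g t k = g k.+1 k.
  elim: t => // t IH; rewrite ltnS leq_eqVlt => /orP[/eqP -> //|kt].
  by rewrite /= {1}/upd ltn_eqF // IH.
have Pg t : forall k, k < t -> P k (g t).
  elim: t => // t IH k; rewrite ltnS leq_eqVlt => /orP[/eqP ->|kt].
    exact: (HF (t, g t)).
  apply: ext (IH k kt) => m mk; rewrite /= /upd ltn_eqF //; exact: leq_ltn_trans kt.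
exists (fun t => g t.+1 t) => t; apply: ext (Pg t.+1 t (leqnn _)) => k kt.
by rewrite gE.
Qed.

Lemma edge_dipath W (a b : W) : a <> b ->
  exists p : dipath W, [/\ pstart p = a, pend p = b, pinner p = set0 &
    path_graph p = edge_graph a b].
Proof.
move=> ab; have inj k l : k <= 1 -> l <= 1 ->
    (if k == 0 then a else b) = (if l == 0 then a else b) -> k = l.
  by case: k l => [|[|k]] [|[|l]] //= _ _ // /esym.
exists (Dipath inj); split=> //.
  by rewrite -subset0 => _ [k /= k1 _]; lia.
apply: digraph_eq; apply/seteqP; split=> x /=.
- by case=> -[|[|k]] //= _ <-; [left|right].
- by case=> ->; [exists 0|exists 1].
- by case=> -[|k] //= _ <-.
- by move=> ->; exists 0.
Qed.

(** Necklace grids are defined through a subdivision; here each edge is replaced by itself. Loops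
    are excluded because a [dipath] does not repeat vertices. *)
Lemma trivial_subdivision W (Q : digraph W) : (forall e, edge Q e -> e.1 <> e.2) ->
  exists P : W * W -> dipath W, subdivision Q Q id P /\
    forall R : nat -> outray W, (forall i, pos i -> edge (R i) `<=` edge Q) ->
    vertical_rays R P R.
Proof.
move=> loopless.
have /choice[P HP] : forall e : W * W, exists p : dipath W, edge Q e ->
    [/\ pstart p = e.1, pend p = e.2, pinner p = set0 & path_graph p = edge_graph e.1 e.2].
  move=> [a b] /=; have [/loopless ab|nQ] := pselect (edge Q (a, b)).
    by have [p ?] := edge_dipath ab; exists p.
  have inj k l : k <= 0 -> l <= 0 -> a = a -> k = l by lia.
  by exists (Dipath inj).
have edgeP e e' : edge Q e -> edge (P e) e' <-> e' = e.
  by move=> /HP[_ _ _ ->]; case: e => a b.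
have vertP e x : edge Q e -> vert (P e) x <-> x = e.1 \/ x = e.2.
  by move=> /HP[_ _ _ ->].
exists P; split.
  split.
  - by [].
  - by move=> e /HP[].
  - by move=> e /HP[_ _ -> _]; rewrite set0I.
  - by move=> e e' /HP[_ _ -> _] _ [x []].
  - apply/seteqP; split=> x; first by move=> Qx; left; exists x.
    case=> [[y Qy <-] //|[e Qe ex]]; have [e1 e2] := edge_vert Qe.
    by case: ((vertP e x Qe).1 ex) => ->.
  - apply/seteqP; split=> e; first by move=> Qe; exists e => //; apply/edgeP.
    by case=> e' Qe' ee'; rewrite ((edgeP e' e Qe').1 ee').
move=> R RQ i i0; apply: digraph_eq; apply/seteqP; split=> x.
- case=> k _ <-; exists (R i k, R i k.+1); first by exists k.
  by apply/vertP; [apply: (RQ i i0); exists k|left].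
- case=> e Re ex; have := (vertP e x (RQ i i0 e Re)).1 ex.
  by case: Re => k _ <- /= [] ->; [exists k|exists k.+1].
- by move=> Rx; exists x => //; apply/edgeP => //; exact: (RQ i i0).
- by case=> e Re ex; rewrite ((edgeP e x (RQ i i0 e Re)).1 ex).
Qed.

(** What the routing asks of [s]: necklaces at consecutive stops of girder [size s] are linked. Rays
    are numbered from 1 and list positions from 0, hence the predecessors. *)
Definition follows (L : nat -> nat) (cyc : nat -> nat -> nat)
    (E : set nat -> nat -> nat -> Prop) (s : seq nat) : Prop :=
  2 <= size s -> forall j, j < L (size s) ->
  E [set` s] (nth 0 s (cyc (size s) j).-1) (nth 0 s (cyc (size s) j.+1).-1).

(* Step [t] routes the [t]-th horizontal path [rpath] between the blocks [rsrc] and [rdst] of the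
   witnesses of its end necklaces. It also chooses a new necklace [rnew], which replaces ray [n] if
   [t = start L n] and is not used otherwise. *)
Record route V := Route { rnew : nat; rpath : dipath V; rsrc : nat; rdst : nat }.

(** * Recursive choice of the necklaces and horizontal paths *)

Section Routing.
Variables (V : Type) (D : digraph V) (N : nat -> digraph V) (H : nat -> nat -> digraph V).
Hypothesis NH : forall i, necklace_witness (N i) (H i).
Hypothesis Ndisj : forall i j x, vert (N i) x -> vert (N j) x -> i = j.
Variables (L : nat -> nat) (cyc : nat -> nat -> nat).
Hypothesis Hs : schedule L cyc.
Variables (a : nat) (Y : set nat).
Hypothesis uY : unbounded Y.
Hypothesis HL : forall s, sorted ltn (a :: s) -> [set` s] `<=` Y ->
  follows L cyc (necklace_link D N) (a :: s).

(** For [i >= 2], girder [i] is the first to visit ray [i], so the necklace of that ray is chosen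
    when girder [i] starts. *)
Definition ray_index (f : nat -> route V) (i : nat) : nat :=
  if i <= 1 then a else rnew (f (start L i)).

(** Inside, the path avoids the necklaces of the rays in use so far; later necklaces are in turn
    chosen off the earlier paths. Block numbers grow by at least two per step, which leaves a block
    in between, and start above 2 to leave room for the root of ray 1. *)
Definition routed (t : nat) (f : nat -> route V) : Prop :=
  [/\ [/\ Y (rnew (f t)), a < rnew (f t), forall k, k < t -> rnew (f k) < rnew (f t) &
          forall k, k < t -> vert (rpath (f k)) `&` vert (N (rnew (f t))) = set0],
      [/\ subdigraph (rpath (f t)) D,
          vert (H (ray_index f (tour L cyc t)) (rsrc (f t))) (pstart (rpath (f t))),
          vert (H (ray_index f (tour L cyc t.+1)) (rdst (f t))) (pend (rpath (f t))),
          forall k, k < t -> vert (rpath (f k)) `&` vert (rpath (f t)) = set0 &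
          forall i, 0 < i <= (stage L t).1 ->
            pinner (rpath (f t)) `&` vert (N (ray_index f i)) = set0] &
      2 < minn (rsrc (f t)) (rdst (f t)) /\ forall k, k < t ->
        (maxn (rsrc (f k)) (rdst (f k))).+1 < minn (rsrc (f t)) (rdst (f t))].

Lemma tour_bound t : tour L cyc t <= (stage L t).1 /\ tour L cyc t.+1 <= (stage L t).1.
Proof.
have [n2 jn tE] := stage_spec Hs t.
split; first by have /andP[] := sched_bound Hs n2 (ltnW jn).
by rewrite {1}tE -addnS tour_start //; have /andP[] := sched_bound Hs n2 jn.
Qed.

Lemma start_stage t i : i <= (stage L t).1 -> start L i <= t.
Proof.
have [n2 jn tE] := stage_spec Hs t; rewrite leq_eqVlt => /orP[/eqP ->|iN].
  by rewrite [leqRHS]tE leq_addr.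
have [i2|i2] := leqP 2 i; first by have := start_leq L i2 iN; lia.
by rewrite /start big_geq // ltnW.
Qed.

Lemma ray_index_ext t f f' i : (forall k, k <= t -> f k = f' k) ->
  i <= (stage L t).1 -> ray_index f i = ray_index f' i.
Proof. by move=> ff' it; rewrite /ray_index ff' // start_stage. Qed.

Lemma routed_ext t f f' : (forall k, k <= t -> f k = f' k) -> routed t f -> routed t f'.
Proof.
move=> ff' [[h1 h2 h3 h4] [h5 h6 h7 h8 h9] [h10 h11]].
have [b1 b2] := tour_bound t; have R := ray_index_ext ff'.
have lt k : k < t -> f k = f' k by move=> kt; apply: ff'; exact: ltnW.
have tt := ff' t (leqnn t).
rewrite /routed -!(R _ b1) -!(R _ b2) -!tt.
split; split=> // k kt; rewrite -?(lt k kt) //; [exact: h3|exact: h4|exact: h8| |exact: h11].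
by rewrite -(R k); [exact: h9|case/andP: kt].
Qed.

Lemma finite_avoid (X : set V) : finite_set X ->
  exists M, forall i, M < i -> X `&` vert (N i) = set0.
Proof.
move=> fX; have /choice[m Hm] : forall x, exists m, forall i, vert (N i) x -> i = m.
  move=> x; have [[i ix]|ni] := pselect (exists i, vert (N i) x).
    by exists i => j jx; exact: Ndisj jx ix.
  by exists 0 => i ix; case: ni; exists i.
have [M HM] := finite_bounded m fX.
exists M => i Mi; rewrite -subset0 => x [Xx ix].
by have := HM x Xx; rewrite -(Hm x i ix) leqNgt Mi.
Qed.

Lemma bounded_below (b : nat -> nat) t : exists M, forall k, k < t -> b k <= M.
Proof.
exists (\max_(k < t) b k) => k kt.
exact: (leq_bigmax (F := fun k : 'I_t => b k) (Ordinal kt)).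
Qed.

(** The index [g] exceeds all earlier ones and is so large that [N g] avoids the earlier paths.
    Applied to the necklaces of rays [1, ..., n], [HL] links the two necklaces in question. *)
Lemma routed_step t f : (forall k, k < t -> routed k f) -> exists x, routed t (upd f t x).
Proof.
move=> Hf; pose X := \bigcup_(k in `I_t) vert (rpath (f k)).
have fX : finite_set X by apply: bigcup_finite => [|k _]; [exact: finite_II|exact: finite_vert_dipath].
have [M1 HM1] := finite_avoid fX.
have [M2 HM2] := bounded_below (fun k => rnew (f k)) t.
have [M HM] := bounded_below (fun k => maxn (rsrc (f k)) (rdst (f k))) t.
have [g] := uY (maxn M1 (maxn M2 a)).+1.
rewrite !gtn_max => /and3P[gM1 gM2 ag] Yg.
have [n2 jn tE] := stage_spec Hs t; have [b1 b2] := tour_bound t.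
set n := (stage L t).1 in n2 jn tE b1 b2 *; set j := (stage L t).2 in jn tE *.
(* This anticipates [ray_index] of the extended function; for [i <= n] the last case means
   [start L i = t], where [g] itself is assigned. *)
pose r i := if i <= 1 then a else if start L i < t then rnew (f (start L i)) else g.
have rmono i k : 0 < i -> i < k -> k <= n -> r i < r k.
  move=> i0 ik kn; have k1 : 1 < k by lia.
  rewrite /r [k <= 1]leqNgt k1 /=; have [i1|i1] := leqP i 1.
    by case: ifP => // kt; have [[_ ? _ _] _ _] := Hf _ kt.
  have sik := start_leq L i1 ik; have Li := sched_pos Hs i1.
  case: ifP => it; last by have := start_stage (t := t) kn; lia.
  case: ifP => kt; last by have := HM2 _ it; lia.
  by have [[_ _ + _] _ _] := Hf _ kt; apply; lia.
pose s := a :: [seq r m | m <- iota 2 n.-1].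
have ss : size s = n by rewrite /= size_map size_iota; lia.
have sr i : 0 < i -> i <= n -> nth 0 s i.-1 = r i.
  case: i => // -[|i] // _ iN; rewrite /s /= (nth_map 0) ?nth_iota ?size_iota //; lia.
have link : necklace_link D N [set` s] (r (tour L cyc t)) (r (tour L cyc t.+1)).
  have jE : tour L cyc t.+1 = cyc n j.+1 by rewrite {1}tE -addnS tour_start.
  have := HL (s := [seq r m | m <- iota 2 n.-1]); rewrite /follows -/s ss.
  have /andP[c0 cn] := sched_bound Hs n2 (ltnW jn); have /andP[c0' cn'] := sched_bound Hs n2 jn.
  move=> h; have {}h := h _ _ n2 j jn; rewrite !sr // in h; rewrite jE; apply: h.
  - apply/(sortedP 0) => i; rewrite ss => iN.
    have := rmono i.+1 i.+2 isT (ltnSn _) iN.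
    by rewrite -(sr i.+1) -?(sr i.+2) //; exact: ltnW.
  - move=> x /= /mapP[m]; rewrite mem_iota => /andP[m2 mn] ->; rewrite /r leqNgt m2 /=.
    by case: ifP => // mt; have [[]] := Hf _ mt.
have rne : r (tour L cyc t) <> r (tour L cyc t.+1).
  have p1 := tour_pos Hs t; have p2 := tour_pos Hs t.+1.
  have [lt|lt|/(tour_turn Hs)//] := ltngtP (tour L cyc t) (tour L cyc t.+1).
    by have := rmono _ _ p1 lt b2; lia.
  by have := rmono _ _ p2 lt b1; lia.
(* Off the blocks up to [M.+3], both ends lie in blocks numbered above 2 and above all earlier block
   numbers by the required gap. *)
pose B i := \bigcup_(l in [set l | 0 < l <= M.+3]) vert (H i l).
have fB i : finite_set (B i).
  apply: bigcup_finite; first by apply: sub_finite_set (finite_II M.+4) => l /= /andP[].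
  by move=> l /= /andP[l0 _]; case: (NH i) => /(_ l l0) [_ []].
have ends i x : vert (N i) x -> ~ B i x -> exists2 l, M.+3 < l & vert (H i l) x.
  have [_ [NE _]] := NH i; rewrite NE => -[l /= l0 xl] nB.
  by exists l => //; rewrite ltnNge; apply/negP => lM; apply: nB; exists l => //=; apply/andP.
have fX2 : finite_set (X `|` (B (r (tour L cyc t)) `|` B (r (tour L cyc t.+1)))).
  by rewrite !finite_setU; split=> //; split.
have [p [pD p1 p2 pX pin]] := linking_path Ndisj rne fX2 link.
have avoid x : vert p x -> (X `|` (B (r (tour L cyc t)) `|` B (r (tour L cyc t.+1)))) x -> False.
  by move=> px Xx; suff : set0 x by []; rewrite -pX.
have [|l1 l1M pl1] := ends _ _ p1.
  by move=> Bp; apply: (avoid (pstart p)); [exists 0|right; left].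
have [|l2 l2M pl2] := ends _ _ p2.
  by move=> Bp; apply: (avoid (pend p)); [exists (plen p) => /=|right; right].
exists (Route g p l1 l2); set f1 := upd f t _.
have f1t : f1 t = Route g p l1 l2 by rewrite /f1 /upd eqxx.
have f1k k : k < t -> f1 k = f k by move=> kt; rewrite /f1 /upd ltn_eqF.
have f1r i : i <= n -> ray_index f1 i = r i.
  move=> iN; rewrite /ray_index /r; case: ifP => // i1.
  have := start_stage (t := t) iN; rewrite leq_eqVlt => /orP[/eqP it|it].
    by rewrite it f1t ltnn.
  by rewrite f1k it.
have pXk k : k < t -> vert (rpath (f k)) `&` vert p = set0.
  by move=> kt; rewrite -subset0 => x [xk xp]; apply: (avoid x xp); left; exists k.
rewrite /routed f1t /= !f1r //; split; split=> //.
- by move=> k kt; rewrite f1k //; apply: leq_ltn_trans (HM2 k kt) gM2.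
- move=> k kt; rewrite f1k // -subset0 => x [xk gx].
  by suff : set0 x by []; rewrite -(HM1 g gM1); split=> //; exists k.
- by move=> k kt; rewrite f1k //; exact: pXk.
- move=> i /andP[i0 iN]; rewrite f1r //; apply: pin; left.
  by rewrite -sr //= ; apply: mem_nth; rewrite ss; lia.
- by lia.
by move=> k kt; rewrite f1k //; have := HM k kt; lia.
Qed.

Lemma routing : exists f, forall t, routed t f.
Proof.
have [x _] : exists x : V, True.
  by have [_ [_ adj]] := NH 0; have [x _] := (adj 1 1 isT isT).2 (conj isT isT); exists x.
have inj k l : k <= 0 -> l <= 0 -> x = x -> k = l by lia.
apply: (history_choice (Route 0 (Dipath inj) 0 0)) => [t f f'|t f].
  exact: routed_ext.
exact: routed_step.
Qed.

End Routing.

(** * The necklace grid obtained from a routing *)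

Section Replacement.
Variables (V : Type) (D : digraph V) (N : nat -> digraph V) (H : nat -> nat -> digraph V).
Hypothesis ND : forall i, subdigraph (N i) D.
Hypothesis Nneck : forall i, necklace (N i).
Hypothesis NH : forall i, necklace_witness (N i) (H i).
Hypothesis Ndisj : forall i j x, vert (N i) x -> vert (N j) x -> i = j.
Variables (L : nat -> nat) (cyc : nat -> nat -> nat).
Hypothesis Hs : schedule L cyc.
Variables (a : nat) (Y : set nat) (f : nat -> route V).
Hypothesis Hf : forall t, routed D N H L cyc a Y t f.

Local Notation c := (tour L cyc).
Local Notation z := (wvtx c).
Local Notation Q := (tour_grid L cyc).
Local Notation r := (ray_index L a f).
Local Notation crossing t := (z t.*2.+1, z t.*2.+2).

Lemma start_stage_lt t i : (stage L t).1 < i -> t < start L i.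
Proof.
have [n2 jn tE] := stage_spec Hs t => ni; have := start_leq L n2 ni; lia.
Qed.

Lemma ray_index_inj i j : 0 < i -> 0 < j -> r i = r j -> i = j.
Proof.
have mono k l : 0 < k -> k < l -> r k < r l.
  move=> k0 kl; have l1 : 1 < l by lia.
  rewrite /ray_index [l <= 1]leqNgt l1 /=.
  have [k1|k1] := leqP k 1; first by have [[]] := Hf (start L l).
  have kl' := start_leq L k1 kl; have Lk := sched_pos Hs k1.
  by have [[_ _ + _] _ _] := Hf (start L l); apply; lia.
move=> i0 j0 E; have [ij|ji|//] := ltngtP i j.
  by have := mono i j i0 ij; lia.
by have := mono j i j0 ji; lia.
Qed.

(** Necklaces in use at step [t] are avoided by the choice of the path, later ones by their own
    choice. *)
Lemma path_avoids t i : 0 < i -> pinner (rpath (f t)) `&` vert (N (r i)) = set0.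
Proof.
move=> i0; have [it|ti] := leqP i (stage L t).1.
  by have [_ [_ _ _ _ +] _] := Hf t; apply; rewrite i0.
have [n2 _ _] := stage_spec Hs t; have ts := start_stage_lt ti.
have [[_ _ _ dis] _ _] := Hf (start L i); have := dis t ts.
have i1 : 1 < i by lia.
rewrite /ray_index [i <= 1]leqNgt i1 /= => E.
rewrite -subset0 => x [[k /= kp <-] xi].
suff : set0 (rpath (f t) k) by [].
by rewrite -E; split=> //; exists k => //=; lia.
Qed.

(* The end of a horizontal path that corresponds to the grid vertex [wvtx c k]; none corresponds to
   [wvtx c 0], the root of ray 1, so [anchor 0] is junk. *)
Definition anchor (k : nat) : V :=
  if odd k then pstart (rpath (f k./2)) else pend (rpath (f k.-1./2)).

(** A block of the original witness that contains [anchor k]. The value 1 at [k = 0] is a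
    placeholder for the root of ray 1, below every routed block by the required gap. *)
Definition anchor_block (k : nat) : nat :=
  if k == 0 then 1 else if odd k then rsrc (f k./2) else rdst (f k.-1./2).

Definition anchor_edge (k : nat) : V * V :=
  let p := rpath (f k.-1./2) in
  if odd k then (p 0, p 1) else (p (plen p).-1, p (plen p)).

Lemma anchor_odd t : anchor t.*2.+1 = pstart (rpath (f t)).
Proof. by rewrite /anchor /= odd_double /= uphalf_double. Qed.

Lemma anchor_even t : anchor t.*2.+2 = pend (rpath (f t)).
Proof. by rewrite /anchor /= odd_double /= uphalf_double. Qed.

Lemma witness_sub i l x : 0 < l -> vert (H i l) x -> vert (N i) x.
Proof. by move=> l0 xl; have [/(_ l l0) [[+ _] _] _] := NH i; apply. Qed.

(** The ends of one horizontal path lie on different rays. So two tour points on the same ray stem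
    from different routing steps, whose block numbers differ by at least two, or the first is the
    root [z 0]. *)
Lemma anchor_block_gap k k' : k < k' -> c k./2 = c k'./2 ->
  (anchor_block k).+1 < anchor_block k'.
Proof.
move=> kk' cE; have nb (t : nat) := tour_turn Hs (t := t).
have blk l : 0 < l -> anchor_block l = rsrc (f l.-1./2) \/ anchor_block l = rdst (f l.-1./2).
  case: l => // l _; rewrite /anchor_block /=; case: ifP => /= ol; [left|by right].
  by have -> : uphalf l = l./2 by lia.
have [_ _ [b2 bgap]] := Hf k'.-1./2.
have k'0 : 0 < k' by lia.
have [k0|k0] := posnP k.
  by subst k; case: (blk k' k'0) => ->; rewrite /anchor_block /=; lia.
have lt : k.-1./2 < k'.-1./2.
  have [//|le] := ltnP k.-1./2 k'.-1./2.
  have kE : k = k.-1./2.*2.+1 by lia.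
  have := @nb k./2; rewrite {1}cE; have -> : k'./2 = k./2.+1 by lia.
  by [].
have := bgap _ lt; case: (blk k k0) => ->; case: (blk k' k'0) => ->; lia.
Qed.

Lemma anchor_block_pos k : 0 < anchor_block k.
Proof.
rewrite /anchor_block; case: eqP => // _; case: ifP => _.
  by have [_ _ [b2 _]] := Hf k./2; lia.
by have [_ _ [b2 _]] := Hf k.-1./2; lia.
Qed.

Lemma anchor_in k : 0 < k -> vert (H (r (c k./2)) (anchor_block k)) (anchor k).
Proof.
case: k => // k _; rewrite /anchor /anchor_block /=; case: ifP => ok.
  by have [_ [_ + _ _ _] _] := Hf (uphalf k).
have -> : uphalf k = k./2.+1 by lia.
by have [_ [_ _ + _ _] _] := Hf k./2.
Qed.

Lemma anchor_on_ray k : 0 < k -> vert (N (r (c k./2))) (anchor k).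
Proof. by move=> k0; exact: witness_sub (anchor_block_pos k) (anchor_in k0). Qed.

Lemma plen_pos t : 0 < plen (rpath (f t)).
Proof.
rewrite lt0n; apply/eqP => p0.
have := @anchor_on_ray t.*2.+1 isT; have := @anchor_on_ray t.*2.+2 isT.
rewrite half_doubleS half_doubleSS anchor_odd anchor_even /pend p0.
move=> h1 h2; apply: (@tour_turn _ _ Hs t).
by apply: ray_index_inj; [exact: (tour_pos Hs)|exact: (tour_pos Hs)|exact: Ndisj h2 h1].
Qed.

Lemma path_edge_anchor t e i x : edge (rpath (f t)) e -> x = e.1 \/ x = e.2 -> 0 < i ->
  vert (N (r i)) x -> exists k, [/\ 0 < k, c k./2 = i, x = anchor k & e = anchor_edge k].
Proof.
move=> [m /= mp <-] xe i0 ix; have p0 := plen_pos t.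
have noin k : 0 < k < plen (rpath (f t)) -> rpath (f t) k <> x.
  move=> kp kx; suff : set0 x by [].
  by rewrite -(path_avoids t i0); split=> //; exists k.
have on k : 0 < k -> vert (N (r i)) (anchor k) -> c k./2 = i.
  by move=> k0 ik; apply: ray_index_inj => //; [exact: tour_pos|exact: Ndisj (anchor_on_ray k0) ik].
have start_case : m = 0 -> x = rpath (f t) m -> exists k, [/\ 0 < k, c k./2 = i, x = anchor k &
    (rpath (f t) m, rpath (f t) m.+1) = anchor_edge k].
  move=> m0 xm; have xa : x = anchor t.*2.+1.
    by rewrite anchor_odd xm m0.
  exists t.*2.+1; split=> //; first by apply: on => //; rewrite -xa.
  by rewrite /anchor_edge /= odd_double /= doubleK m0.
have end_case : m.+1 = plen (rpath (f t)) -> x = rpath (f t) m.+1 ->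
    exists k, [/\ 0 < k, c k./2 = i, x = anchor k &
    (rpath (f t) m, rpath (f t) m.+1) = anchor_edge k].
  move=> mp' xm; have xa : x = anchor t.*2.+2.
    by rewrite anchor_even xm mp'.
  exists t.*2.+2; split=> //; first by apply: on => //; rewrite -xa.
  by rewrite /anchor_edge /= odd_double /= uphalf_double -mp'.
case: xe => /= xm.
  have [m0|m0] := posnP m; first exact: start_case.
  by case: (noin m) => //; rewrite m0.
have [lt|ge] := ltnP m.+1 (plen (rpath (f t))); first by case: (noin m.+1).
by apply: end_case => //; lia.
Qed.

Lemma tour_grid_loopless e : edge Q e -> e.1 <> e.2.
Proof.
case=> [[i _ [k _ <-]]|[n _ /wseg_edge[k _ ->]]] /=; first by case; lia.
by move=> /wvtx_inj; lia.
Qed.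

Lemma grid_replacement : exists D', subdigraph D' D /\ exists P P' H',
  [/\ subdivision Q Q id P, vertical_rays grid_ray P grid_ray &
      ray_replacement grid_ray Q P grid_ray D' (fun i => N (r i)) H' P'].
Proof.
have [P [sP vP]] := trivial_subdivision tour_grid_loopless.
have rayP : vertical_rays grid_ray P grid_ray by apply: vP => i i0 e ie; left; exists i.
have /choice[P' HP'] : forall e, exists p, forall t, e = crossing t -> p = rpath (f t).
  move=> e; have [[t tE]|nt] := pselect (exists t, e = crossing t).
    exists (rpath (f t)) => t'; rewrite tE => /(congr1 fst) /wvtx_inj tt'.
    by have -> : t = t' by lia.
  by exists (rpath (f 0)) => t tE; case: nt; exists t.
have P'E t : P' (crossing t) = rpath (f t) by exact: HP'.
have /choice[kap Hkap] : forall im : nat * nat, exists k, 0 < im.1 -> 0 < im.2 -> z k = im.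
  move=> [i m] /=; have [i0|i0] := ltnP 0 i; last by exists 0; lia.
  have [m0|m0] := ltnP 0 m; last by exists 0; lia.
  by have [|k kE] := @wvtx_surj c i m _ m0; [move=> T; exact: (tour_inf Hs)|exists k].
(* If [b] is the block of the anchor at position [m] of ray [i], the new block [m.*2.-1] ends with
   [b], and the new block [m.*2] is the single old block [b.+1]. So anchors fall into odd blocks,
   each followed by a spacer. *)
pose cut i l := if l is l'.+1 then anchor_block (kap (i, l'./2.+1)) + odd l' else 0.
have cut_incr i l : 0 < i -> cut i l < cut i l.+1.
  move=> i0; case: l => [|l] /=; first by rewrite ltn_addr // anchor_block_pos.
  have [ol|el] := boolP (odd l).
    have zk := Hkap (i, l./2.+1) i0 isT; have zk' := Hkap (i, (uphalf l).+1) i0 isT.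
    have kk' : kap (i, l./2.+1) < kap (i, (uphalf l).+1).
      rewrite ltnNge; apply/negP; rewrite leq_eqVlt => /orP[/eqP kE|/(@wvtx_mono c)].
        by move: zk'; rewrite kE zk => /(congr1 snd) /=; lia.
      by rewrite zk zk' /= => /(_ erefl); lia.
    have cE : c (kap (i, l./2.+1))./2 = c (kap (i, (uphalf l).+1))./2.
      by move/(congr1 fst): zk; move/(congr1 fst): zk' => /= -> ->.
    by have := anchor_block_gap kk' cE; rewrite /=; lia.
  have -> : uphalf l = l./2 by lia.
  by move=> /=; lia.
pose H' i := coarsen (H (r i)) (cut i).
have H'W i : 0 < i -> necklace_witness (N (r i)) (H' i).
  by move=> i0; apply: coarsen_witness => // l; exact: cut_incr.
have anchored k : 0 < k -> vert (H' (c k./2) (z k).2.*2.-1) (anchor k).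
  move=> k0; exists (anchor_block k); last exact: anchor_in.
  have m0 : 0 < (z k).2 by [].
  have kE : kap (c k./2, (z k).2) = k.
    by apply: (@wvtx_inj c); rewrite Hkap //; exact: tour_pos.
  have cutE : cut (c k./2) (z k).2.*2.-1 = anchor_block k.
    case: ((z k).2) m0 kE => // m _ kE; rewrite doubleS /=.
    by rewrite odd_double doubleK addn0 kE.
  have lt l : 0 < l -> cut (c k./2) l.-1 < cut (c k./2) l.
    by case: l => // l _; exact/cut_incr/(tour_pos Hs).
  have m2 : 0 < (z k).2.*2.-1 by lia.
  by have := lt _ m2; rewrite cutE => ltk; apply/andP; split.
have H'sub i l x : 0 < i -> 0 < l -> vert (H' i l) x -> vert (N (r i)) x.
  by move=> i0 l0; have [/(_ l l0) [[+ _] _] _] := H'W i i0; apply.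
pose D' := dU (bigdU pos (fun i => N (r i)))
  (bigdU (horizontal_edges grid_ray Q) (fun e => P' e : digraph V)).
have touch e i x : edge D' e -> ~ edge (N (r i)) e -> 0 < i -> x = e.1 \/ x = e.2 ->
    vert (N (r i)) x -> exists k, [/\ 0 < k, c k./2 = i, x = anchor k & e = anchor_edge k].
  move=> [[j j0 je]|[e' /(horizontal_edgesP Hs)[t ->] te]] ne i0 xe ix.
    have jx : vert (N (r j)) x by have [? ?] := edge_vert je; case: xe => ->.
    by case: ne; rewrite (Ndisj ix jx).
  by rewrite P'E in te; exact: path_edge_anchor te xe i0 ix.
exists D'; split.
  split=> x.
    case=> [[i _]|[e /(horizontal_edgesP Hs)[t ->]]]; first by case: (ND (r i)) => + _; apply.
    by rewrite P'E; have [_ [[+ _] _ _ _ _] _] := Hf t; apply.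
  case=> [[i _]|[e /(horizontal_edgesP Hs)[t ->]]]; first by case: (ND (r i)) => _; apply.
  by rewrite P'E; have [_ [[_ +] _ _ _ _] _] := Hf t; apply.
exists P, P', H'; split=> //; split.
- by move=> i i0; split; [exact: Nneck|exact: H'W].
- move=> i j i0 j0 [x [ix jx]]; exact: ray_index_inj (Ndisj ix jx).
- move=> e e' /(horizontal_edgesP Hs)[t ->] /(horizontal_edgesP Hs)[t' ->]; rewrite !P'E.
  move=> [x [tx t'x]]; have [tt'|t't|-> //] := ltngtP t t'.
    have [_ [_ _ _ /(_ t tt') E _] _] := Hf t'.
    by suff : set0 x by []; rewrite -E.
  have [_ [_ _ _ /(_ t' t't) E _] _] := Hf t.
  by suff : set0 x by []; rewrite -E.
- move=> i j e /(horizontalP Hs)[t [-> -> ->]]; rewrite P'E.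
  have := @anchor_on_ray t.*2.+1 isT; have := @anchor_on_ray t.*2.+2 isT.
  by rewrite half_doubleS half_doubleSS anchor_odd anchor_even.
- by move=> e k /(horizontal_edgesP Hs)[t ->] k0; rewrite P'E; exact: path_avoids.
- by [].
- move=> i l i0 ol e1 e2 D1 n1 l1 D2 n2 l2.
  have l0 : 0 < l by case: (l) ol.
  (* An anchor at position [m] that lies in block [l] also lies in block [m.*2.-1]; the two blocks
     meet and both numbers are odd, so they agree. Hence [l] determines the anchor and its edge. *)
  have block e : edge D' e -> ~ edge (N (r i)) e -> vert (H' i l) e.1 \/ vert (H' i l) e.2 ->
      exists k, [/\ 0 < k, e = anchor_edge k, c k./2 = i & l = (z k).2.*2.-1].
    move=> De ne le; have [x [xe lx]] : exists x, (x = e.1 \/ x = e.2) /\ vert (H' i l) x.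
      by case: le => ?; [exists e.1|exists e.2]; split=> //; [left|right].
    have [k [k0 ki xk eE]] := touch e i x De ne i0 xe (H'sub i l x i0 l0 lx).
    exists k; split=> //.
    have := anchored k k0; rewrite ki -xk => kx; have [_ [_ adj]] := H'W i i0.
    have m0 : 0 < (z k).2 by [].
    have mpos : pos (z k).2.*2.-1 by rewrite /pos /=; lia.
    have [/(_ (ex_intro _ x (conj lx kx))) [? ?] _] := adj _ _ l0 mpos.
    by lia.
  have [k1 [k10 -> c1 lE1]] := block e1 D1 n1 l1; have [k2 [k20 -> c2 lE2]] := block e2 D2 n2 l2.
  have m1 : 0 < (z k1).2 by []. have m2 : 0 < (z k2).2 by [].
  have -> // : k1 = k2.
  apply: (@wvtx_inj c); have : (z k1).1 = (z k2).1 by rewrite /= c1 c2.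
  have : (z k1).2 = (z k2).2 by lia.
  by case: (z k1) => ? ?; case: (z k2) => ? ? /= -> ->.
- move=> i l i0 l0 el e De ne lint.
  have [x [xe [lx /not_orP[nlx1 nlx2]]]] : exists x, (x = e.1 \/ x = e.2) /\ interior (H' i) l x.
    by case: lint => ?; [exists e.1|exists e.2]; split=> //; [left|right].
  have [k [k0 ki xk eE]] := touch e i x De ne i0 xe (H'sub i l x i0 l0 lx).
  have := anchored k k0; rewrite ki -xk => kx; have [_ [_ adj]] := H'W i i0.
  have m0 : 0 < (z k).2 by [].
  have mpos : pos (z k).2.*2.-1 by rewrite /pos /=; lia.
  have [/(_ (ex_intro _ x (conj lx kx))) [? ?] _] := adj _ _ l0 mpos.
  have l1 : 0 < l by [].
  (* The anchor lies in an odd block that meets the even block [l], hence in a neighbour of it and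
     outside its interior. *)
  have [E|E] : (z k).2.*2.-1 = l.-1 \/ (z k).2.*2.-1 = l.+1 by lia.
    by apply: nlx1; rewrite -E.
  by apply: nlx2; rewrite -E.
- move=> i i0 e1 e2 x y x' y' h1 h2 x1 y2 [k [l [kl [xk yl]]]].
  have corr e w w' : horizontal_edges grid_ray Q e -> corresponding_ends (P e) (P' e) w w' ->
      exists2 k, 0 < k & w = z k /\ w' = anchor k.
    move=> he; have Qe : edge Q e by case: he => ? [? [_ [_ [_ []]]]].
    have [es ee] := subdiv_ends sP Qe.
    case: he => [? [? /(horizontalP Hs)[t [_ _ eE]]]]; subst e.
    case=> -[-> ->]; rewrite ?es ?ee P'E -?anchor_odd -?anchor_even.
      by exists t.*2.+1.
    by exists t.*2.+2.
  have [k1 k10 [xE x'E]] := corr _ _ _ h1 x1; have [k2 k20 [yE y'E]] := corr _ _ _ h2 y2.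
  have m1 : 0 < (z k1).2 by []. have m2 : 0 < (z k2).2 by [].
  have z1 : z k1 = (i, k + (i == 1)) by rewrite -xE xk.
  have z2 : z k2 = (i, l + (i == 1)) by rewrite -yE yl.
  exists (z k1).2.*2.-1, (z k2).2.*2.-1; split; first by lia.
  split; first by lia.
  split; first by rewrite z1 z2 /=; rewrite z1 z2 /= in m1 m2; lia.
  have c1 : c k1./2 = i by move/(congr1 fst): z1.
  have c2 : c k2./2 = i by move/(congr1 fst): z2.
  by rewrite x'E y'E -{1}c1 -c2; split; exact: anchored.
Qed.

End Replacement.

(** * From linked families to necklace grids *)

Lemma bidirected_follows E s : bidirected E s -> follows (fun n => n.-1.*2) bi_cyc E s.
Proof.
move=> [up down] s2 j jn; rewrite /bi_cyc.
have [js|sj] := ltnP j (size s).-1.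
  have -> : j < size s by lia.
  have -> : j.+1 < size s by lia.
  by apply: up; lia.
have -> : (if j < size s then j.+1 else (size s).*2.-1 - j).-1 = ((size s).*2 - j.+3).+1.
  by case: ifP; lia.
have -> : (if j.+1 < size s then j.+2 else (size s).*2.-1 - j.+1).-1 = (size s).*2 - j.+3.
  by case: ifP; lia.
by apply: down; lia.
Qed.

Lemma asc_follows E s : asc_cyclic E s -> follows id asc_cyc E s.
Proof.
move=> [up back] s2 j jn; rewrite /asc_cyc jn; case: ifP => js; first exact: up.
by have := back s2; rewrite -nth_last -nth0; have -> : (size s).-1 = j by lia.
Qed.

Lemma desc_follows E s : desc_cyclic E s -> follows id desc_cyc E s.
Proof.
move=> [down front] s2 [|j] jn; rewrite /desc_cyc /=.
  by have := front s2; rewrite -nth_last -nth0 subn1.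
have -> : ((size s).+1 - j.+1).-1 = ((size s).+1 - j.+2).-1.+1 by lia.
by apply: down; lia.
Qed.

Theorem theorem1p4 (V : Type) (D : digraph V) (NN : set (digraph V)) :
  infinite_set NN ->
  (forall N, NN N -> subdigraph N D /\ necklace N) ->
  trivIset NN (@vert V) ->
  (forall N1 N2, NN N1 -> NN N2 -> N1 <> N2 -> necklace_equiv D N1 N2) ->
  exists (D' : digraph V) (N : nat -> digraph V),
    subdigraph D' D /\
    (bidirected_necklace_grid D' N \/ cyclic_necklace_grid D' N) /\
    (forall i, 0 < i -> NN (N i)).
Proof.
move=> /infiniteP/card_leP[e] NND NNdisj NNequiv.
pose f (i : nat) : digraph V := val (e (to_setT i)).
have fNN i : NN (f i) by have := valP (e (to_setT i)); rewrite inE.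
have finj i j : f i = f j -> i = j.
  by move=> /val_inj /(@inj _ _ _ e) E; have /(congr1 val) := E (in_setT _) (in_setT _).
have ND i := (NND _ (fNN i)).1; have Nneck i := (NND _ (fNN i)).2.
have Ndisj i j x : vert (f i) x -> vert (f j) x -> i = j.
  by move=> ix jx; apply/finj/(NNdisj _ _ (fNN i) (fNN j)); exists x.
have Nequiv i j : i <> j -> necklace_equiv D (f i) (f j).
  by move=> ij; apply: NNequiv => // /finj.
have /choice[H NH] : forall i, exists H, necklace_witness (f i) H by move=> i; case: (Nneck i).
have HE := necklace_link_system ND Nneck Ndisj Nequiv.
have build L cyc (good : seq nat -> Prop) : schedule L cyc ->
    (forall s, good s -> follows L cyc (necklace_link D f) s) -> rooted_infinite good ->
    exists D' N, [/\ subdigraph D' D, forall i, 0 < i -> NN (N i) &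
      forall grid : (forall W : Type, (nat -> outray W) -> digraph W -> Prop),
        grid _ grid_ray (tour_grid L cyc) -> necklace_grid_over grid D' N].
  move=> Hs fol [a [Y [uY HL]]].
  have [g Hg] := routing NH Ndisj Hs uY (fun s ss sY => fol _ (HL s ss sY)).
  have [D' [D'D [P [P' [H' [sP vP rP]]]]]] := grid_replacement ND Nneck NH Ndisj Hs Hg.
  exists D', (fun i => f (ray_index L a g i)); split=> // grid gQ.
  exists (nat * nat)%type, (nat * nat)%type, grid_ray, (tour_grid L cyc).
  by exists (tour_grid L cyc), id, P, grid_ray, H', P'.
have [B|[A|C]] := linked_subfamily HE.
- have [D' [N [D'D NN' G]]] := build _ _ _ bi_schedule (@bidirected_follows _) B.
  exists D', N; split=> //; split=> //; left; apply: G; exact: bi_quarter_grid.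
- have [D' [N [D'D NN' G]]] := build _ _ _ asc_schedule (@asc_follows _) A.
  exists D', N; split=> //; split=> //; right; apply: G; left; exact: asc_quarter_grid.
- have [D' [N [D'D NN' G]]] := build _ _ _ desc_schedule (@desc_follows _) C.
  exists D', N; split=> //; split=> //; right; apply: G; right; exact: desc_quarter_grid.
Qed.
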